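(* MAT-free arrangements are accurate. That is, if $\mathscr{A}$ is an MAT-free arrangement in $V\cong\mathbb{K}^\ell$, where $\mathbb{K}=\mathbb{R}$ or $\mathbb{K}=\mathbb{C}$, then $\mathscr{A}$ is accurate.
   Context: An arrangement in $V\cong\mathbb{K}^\ell$ ($\mathbb{K}=\mathbb{R}$ or $\mathbb{C}$) is a finite set $\mathscr{A}$ of linear hyperplanes of $V$; $L(\mathscr{A})$ is the set of all intersections $\bigcap_{H\in\mathscr{B}}H$, $\mathscr{B}\subseteq\mathscr{A}$ (the empty intersection is $V$). For $X\in L(\mathscr{A})$, $\mathscr{A}_X=\{H\in\mathscr{A}\mid H\supseteq X\}$ and the restriction is the arrangement $\mathscr{A}^X=\{H\cap X\mid H\in\mathscr{A}\setminus\mathscr{A}_X\}$ in $X$. $\mathrm{rk}(X)=\ell-\dim X$ and $\mathrm{rk}(\mathscr{A})=\mathrm{rk}(\bigcap_{H\in\mathscr{A}}H)$. Let $S=\mathrm{Sym}(V^* )\cong\mathbb{K}[x_1,\dots,x_\ell]$, and for $H\in\mathscr{A}$ fix $\alpha_H\in V^*$ with $H=\ker\alpha_H$. $D(\mathscr{A})=\{\theta\in\mathrm{Der}_{\mathbb{K}}(S)\mid\theta(\alpha_H)\in\alpha_HS\text{ for all }H\in\mathscr{A}\}$. A derivation $\theta=\sum f_i\,\partial/\partial x_i$ is homogeneous of degree $p$ if all $f_i$ are homogeneous of polynomial degree $p$ (or zero). $\mathscr{A}$ is free if $D(\mathscr{A})$ is a free $S$-module; then its exponents $\exp(\mathscr{A})$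 are the degrees of a homogeneous basis of $D(\mathscr{A})$. The empty arrangement in $V$ is free with exponents $(0,\dots,0)$. MAT-free: there is an ordered partition $\pi=(\pi_1|\cdots|\pi_n)$ of $\mathscr{A}$ such that, with $\mathscr{A}_0$ the empty arrangement in $V$ and $\mathscr{A}_k=\bigcup_{i=1}^k\pi_i$ for $1\le k\le n$, for every $0\le k\le n-1$: (1) $\mathrm{rk}(\pi_{k+1})=|\pi_{k+1}|$; (2) $\bigcap_{H\in\pi_{k+1}}H\not\subseteq\bigcup_{H'\in\mathscr{A}_k}H'$; (3) $|\mathscr{A}_k|-|(\mathscr{A}_k\cup\{H\})^H|=k$ for each $H\in\pi_{k+1}$. Accurate: $\mathscr{A}$ is free with exponents $e_1\le e_2\le\dots\le e_\ell$, and for every $1\le d\le\ell$ there is an intersection $X$ of hyperplanes from $\mathscr{A}$ with $\dim X=d$ such that $\mathscr{A}^X$ is free with exponents $e_1\le e_2\le\dots\le e_d$.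
   Formalization: As stated this fails for non-essential arrangements (e.g. a single hyperplane in K^3 has no intersection of dimension 1); accuracy is proved for essential arrangements and, for all MAT-free ones, for every d from max(1, dim of the intersection of all hyperplanes) to ℓ. *)

(* Defs.v *)
From HB Require Import structures.
From mathcomp Require Import all_boot all_order all_algebra.
From mathcomp Require Import finmap mpoly.

Set Implicit Arguments.
Unset Strict Implicit.
Unset Printing Implicit Defensive.

Import GRing.Theory.
Local Open Scope fset_scope.
Local Open Scope ring_scope.

(* Sym(V^* ) is represented as the polynomial ring in the coordinates 'X_i dual
   to the basis [vbasis {:V}] of V. *)
Notation symalg K V := {mpoly K[\dim (fullv : {vspace V})]}.

Section Arrangements.
Variables (K : fieldType) (V : vectType K).
Implicit Types (A B : {fset {vspace V}}) (H X : {vspace V}).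

(* The form [(\dim H).+1 = _] avoids truncated subtraction: a zero-dimensional
   space has no hyperplane. *)
Definition arrangement A : Prop :=
  forall H, H \in A -> (\dim H).+1 = \dim {:V}.

Definition center A : {vspace V} := (\bigcap_(H <- A) H)%VS.

Definition rk A : nat := (\dim {:V} - \dim (center A))%N.

Definition essential A : Prop := rk A = \dim {:V}.

Definition in_lattice A X : Prop :=
  exists2 B : {fset {vspace V}}, B `<=` A & X = center B.

Definition localization A X : {fset {vspace V}} :=
  [fset H in A | (X <= H)%VS].

(* The ambient space of the restriction is X itself, i.e. [subvs_of X]; H :&: X
   seen inside it is the preimage of H under the inclusion [vsval] into V. *)
Definition restriction A X : {fset {vspace (subvs_of X)}} :=
  [fset (linfun (vsval : subvs_of X -> V) @^-1: H)%VS
     | H in A `\` localization A X].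

Definition form_poly (a : 'Hom(V, K^o)) : symalg K V :=
  \sum_(i < \dim {:V}) (a (tnth (vbasis {:V}) i) : K) *: 'X_i.

Definition derivation (t : symalg K V -> symalg K V) : Prop :=
  (forall (c : K) p q, t (c *: p + q) = c *: t p + t q) /\
  (forall p q, t (p * q) = t p * q + p * t q).

(* Two linear forms with the same hyperplane as kernel differ by a nonzero
   scalar, so asking for all of them is the same as fixing one alpha_H. *)
Definition logarithmic A (t : symalg K V -> symalg K V) : Prop :=
  derivation t /\
  forall H (a : 'Hom(V, K^o)), H \in A -> lker a = H ->
    exists q, t (form_poly a) = form_poly a * q.

Definition log_basis A (n : nat)
    (t : 'I_n -> symalg K V -> symalg K V) : Prop :=
  (forall i, logarithmic A (t i)) /\
  (forall u, logarithmic A u ->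
     exists! g : {ffun 'I_n -> symalg K V},
       forall p, u p = \sum_(i < n) g i * t i p).

(* D(A) is finitely generated, so a basis of it is necessarily finite. *)
Definition is_free A : Prop :=
  exists (n : nat) (t : 'I_n -> symalg K V -> symalg K V), log_basis A t.

(* The coefficient of the partial derivative with respect to 'X_j is t 'X_j;
   the zero polynomial is d.-homog for every d. *)
Definition homog_der (d : nat) (t : symalg K V -> symalg K V) : Prop :=
  forall j : 'I_(\dim {:V}), t 'X_j \is d.-homog.

Definition exponents A (e : seq nat) : Prop :=
  exists2 t : 'I_(size e) -> symalg K V -> symalg K V,
    log_basis A t & forall i : 'I_(size e), homog_der (nth 0%N e i) (t i).

Definition free_with_exponents A (e : seq nat) : Prop :=
  is_free A /\ exponents A e.

Definition ordered_partition A (pi : seq {fset {vspace V}}) : Prop :=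
  [/\ forall B, B \in pi -> B != fset0,
      forall i j, (i < j < size pi)%N ->
        [disjoint nth fset0 pi i & nth fset0 pi j]
    & A = \bigcup_(B <- pi) B].

(* [take k pi] has union A_k, and [nth fset0 pi k] is the block pi_(k+1). *)
Definition MAT_partition (pi : seq {fset {vspace V}}) : Prop :=
  forall k, (k < size pi)%N ->
    let Ak := \bigcup_(B <- take k pi) B in
    let P := nth fset0 pi k in
    [/\ rk P = #|` P|,
        ~ (forall v, v \in center P -> exists2 H', H' \in Ak & v \in H')
      & forall H, H \in P ->
          (#|` Ak| - #|` restriction (H |` Ak) H|)%N = k].

Definition MAT_free A : Prop :=
  exists2 pi, ordered_partition A pi & MAT_partition pi.

End Arrangements.

Section Accurate.
Variables (K : fieldType) (V : vectType K).
Implicit Types (A : {fset {vspace V}}).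

Definition accurate_from (m : nat) A : Prop :=
  exists e : seq nat,
    [/\ size e = \dim {:V}, sorted leq e, free_with_exponents A e
      & forall d, (m <= d <= \dim {:V})%N ->
          exists X : {vspace V},
            [/\ in_lattice A X, \dim X = d
              & free_with_exponents (restriction A X) (take d e)]].

Definition accurate A : Prop := accurate_from 1 A.

End Accurate.

(* Main.v *)
Require Import Defs.
From HB Require Import structures.
From mathcomp Require Import all_boot all_order all_algebra.
From mathcomp Require Import finmap mpoly reals complex.
From mathcomp Require Import ring zify.
From Stdlib Require Import Classical.

(* The multiple addition theorem is reproved with control over the bases.  Let
   A_k be free with a homogeneous basis T_1, ..., T_l of degrees at most k, and
   let the forms a_1, ..., a_q define the next block.  For theta in D(A_k),
   theta(a_t) modulo a_t is a multiple of Terao's polynomial B_t, whose degree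
   is |A_k| - |A_k^H| = k.  Hence only the T_i of degree k matter modulo a_t, and
   there T_i(a_t) = c_it B_t with c_it constant.  Evaluating at a point of the
   new hyperplanes off A_k (where det T is nonzero by Saito) shows that (c_it)
   has rank q, so a constant change of basis yields q elements U_t of degree k
   with U_t(a_s) in (a_s) for s <> t and all other basis elements tangent to the
   new hyperplanes; replacing U_t by a_t U_t gives a basis of D(A_(k+1)).

   Restricting such a basis to the intersection X of any of the new hyperplanes
   and dropping the corresponding a_t U_t gives a basis of D(A_(k+1)^X): one
   restricts one hyperplane at a time, and the determinant factors exactly,
   because B divides the removed entry and the restricted forms divide the rest.

   For dimension d, take the last block with at least l - d hyperplanes and let
   X be the intersection of l - d of them, chosen to contain those whose rows are
   used as the U_t of the next block.  Later steps change the remaining d basis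
   elements only by elements vanishing on X, so these stay tangent to all of A,
   and their restrictions are a basis of D(A^X) with the d smallest exponents. *)

Set Implicit Arguments.
Unset Strict Implicit.
Unset Printing Implicit Defensive.

Import GRing.Theory.
Local Open Scope fset_scope.
Local Open Scope ring_scope.

(** * Linear forms and linear substitutions *)

Definition pdvd (S : comNzRingType) (p q : S) : Prop := exists r, q = p * r.

Section Pdvd.
Variable S : comNzRingType.
Implicit Types p q r : S.

Lemma pdvd_refl p : pdvd p p.
Proof. by exists 1; rewrite mulr1. Qed.

Lemma pdvd0 p : pdvd p 0.
Proof. by exists 0; rewrite mulr0. Qed.

Lemma pdvd1 p : pdvd 1 p.
Proof. by exists p; rewrite mul1r. Qed.

Lemma pdvd_mulr p q r : pdvd p q -> pdvd p (q * r).
Proof. by move=> [a ->]; exists (a * r); rewrite mulrA. Qed.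

Lemma pdvd_mull p q r : pdvd p q -> pdvd p (r * q).
Proof. by move=> h; rewrite mulrC; apply: pdvd_mulr. Qed.

Lemma pdvd_add p q r : pdvd p q -> pdvd p r -> pdvd p (q + r).
Proof. by move=> [a ->] [b ->]; exists (a + b); rewrite mulrDr. Qed.

Lemma pdvd_sum (I : Type) (s : seq I) (P : pred I) p (F : I -> S) :
  (forall i, P i -> pdvd p (F i)) -> pdvd p (\sum_(i <- s | P i) F i).
Proof.
by move=> h; apply: (big_ind (pdvd p)) => //; [exact: pdvd0 | exact: pdvd_add].
Qed.

End Pdvd.

Section LinearForms.
Variable K : fieldType.

Definition lin n (a : 'rV[K]_n) : {mpoly K[n]} := \sum_i a 0 i *: 'X_i.

Lemma lin_is_linear n : linear (@lin n).
Proof.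
move=> c a b; rewrite /lin scaler_sumr -big_split /=.
by apply: eq_bigr => i _; rewrite !mxE scalerDl scalerA.
Qed.
HB.instance Definition _ n :=
  GRing.isLinear.Build K 'rV[K]_n {mpoly K[n]} _ (@lin n) (@lin_is_linear n).

Lemma meval_lin n (a : 'rV[K]_n) (v : 'I_n -> K) :
  (lin a).@[v] = \sum_i a 0 i * v i.
Proof. by rewrite raddf_sum; apply: eq_bigr => i _; rewrite /= mevalZ mevalXU. Qed.

Lemma mcoeff_lin n (a : 'rV[K]_n) i : (lin a)@_U_(i) = a 0 i.
Proof.
rewrite raddf_sum (bigD1 i) //= mcoeffZ mcoeffXU eqxx mulr1 big1 ?addr0 // => j.
by rewrite mcoeffZ mcoeffXU => /negPf ->; rewrite mulr0.
Qed.

Lemma lin_inj n : injective (@lin n).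
Proof. by move=> a b e; apply/rowP => i; rewrite -!mcoeff_lin e. Qed.

Lemma lin_eq0 n (a : 'rV[K]_n) : (lin a == 0) = (a == 0).
Proof. by rewrite -(inj_eq (@lin_inj n)) raddf0. Qed.

Lemma lin_delta n (i : 'I_n) : lin (delta_mx 0 i) = 'X_i.
Proof.
rewrite /lin (bigD1 i) //= mxE !eqxx scale1r big1 ?addr0 // => j /negPf h.
by rewrite mxE h andbF scale0r.
Qed.

Lemma lin_homog n (a : 'rV[K]_n) : lin a \is 1.-homog.
Proof.
by apply: rpred_sum => i _; apply: rpredZ; rewrite dhomogX /= mdeg1.
Qed.

(** Row [i] of [P] is the form substituted for ['X_i], so [P] acts on coefficient rows from the
    right, while points are moved by [P^T]. *)
Definition lsub n m (P : 'M[K]_(n, m)) (p : {mpoly K[n]}) : {mpoly K[m]} :=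
  p \mPo [tuple lin (row i P) | i < n].

HB.instance Definition _ n m (P : 'M[K]_(n, m)) :=
  GRing.RMorphism.copy (lsub P) (comp_mpoly [tuple lin (row i P) | i < n]).
HB.instance Definition _ n m (P : 'M[K]_(n, m)) :=
  GRing.Linear.copy (lsub P) (comp_mpoly [tuple lin (row i P) | i < n]).

Lemma lsubX n m (P : 'M[K]_(n, m)) i : lsub P 'X_i = lin (row i P).
Proof. by rewrite /lsub comp_mpolyXU nth_mktuple. Qed.

Lemma lsubC n m (P : 'M[K]_(n, m)) c : lsub P c%:MP = c%:MP.
Proof. exact: comp_mpolyC. Qed.

Lemma lsub_lin n m (P : 'M[K]_(n, m)) a : lsub P (lin a) = lin (a *m P).
Proof.
rewrite raddf_sum mulmx_sum_row raddf_sum; apply: eq_bigr => i _.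
by rewrite /= !linearZ /= lsubX.
Qed.

Lemma lsubXm n m (P : 'M[K]_(n, m)) (mm : 'X_{1..n}) :
  lsub P 'X_[mm] = \prod_(i < n) lin (row i P) ^+ mm i.
Proof.
by rewrite /lsub comp_mpolyX; apply: eq_bigr => i _; rewrite tnth_mktuple.
Qed.

Lemma meval_lsub n m (P : 'M[K]_(n, m)) p (v : 'rV[K]_m) :
  (lsub P p).@[fun i => v 0 i] = p.@[fun i => (v *m P^T) 0 i].
Proof.
rewrite /lsub comp_mpoly_meval; apply: meval_eq => i.
rewrite tnth_mktuple meval_lin !mxE; apply: eq_bigr => j _.
by rewrite !mxE mulrC.
Qed.

End LinearForms.

Opaque lsub.

Section Substitution.
Variable K : fieldType.

(** Constants and variables generate the ring, so identities between ring morphisms or derivations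
    can be checked on these generators. *)
Lemma mpoly_rmorph_ind n (Q : {mpoly K[n]} -> Prop) :
  (forall c, Q c%:MP) -> (forall i, Q 'X_i) ->
  (forall p q, Q p -> Q q -> Q (p + q)) ->
  (forall p q, Q p -> Q q -> Q (p * q)) -> forall p, Q p.
Proof.
move=> hC hX hD hM p.
have hXm m : Q 'X_[m].
  rewrite mpolyXE_id; apply: (big_ind Q) => //; first exact: (hC 1).
  move=> i _; elim: (m i) => [|k IH]; first exact: (hC 1).
  by rewrite exprS; apply: hM.
elim/mpolyind: p => [|c m p _ _ IH]; first exact: (hC 0).
by apply: hD => //; rewrite -mul_mpolyC; apply: hM.
Qed.

Lemma lsub_comp n m l (P : 'M[K]_(n, m)) (Q : 'M[K]_(m, l)) p :
  lsub Q (lsub P p) = lsub (P *m Q) p.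
Proof.
elim/mpoly_rmorph_ind: p => [c|i|p q e1 e2|p q e1 e2].
- by rewrite !lsubC.
- by rewrite !lsubX lsub_lin row_mul.
- by rewrite !rmorphD /= e1 e2.
- by rewrite !rmorphM /= e1 e2.
Qed.

Lemma lsub1 n p : lsub (1%:M : 'M[K]_n) p = p.
Proof.
elim/mpoly_rmorph_ind: p => [c|i|p q e1 e2|p q e1 e2].
- by rewrite lsubC.
- rewrite lsubX rowE mulmx1. exact: lin_delta.
- by rewrite rmorphD /= e1 e2.
- by rewrite rmorphM /= e1 e2.
Qed.

Lemma lsub_pdvd n m (P : 'M[K]_(n, m)) p q :
  pdvd p q -> pdvd (lsub P p) (lsub P q).
Proof. by move=> [r ->]; exists (lsub P r); rewrite rmorphM. Qed.

(* The substitution by [proj u a] restricts functions to the hyperplane [a = 0]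
   and extends them back along the direction [u]. *)
Definition proj n (u a : 'rV[K]_n) : 'M[K]_n := 1%:M - u^T *m a.

Definition dot n (a u : 'rV[K]_n) : K := (a *m u^T) 0 0.

Lemma dotE n (a u : 'rV[K]_n) : a *m u^T = (dot a u)%:M.
Proof. by rewrite [LHS]mx11_scalar. Qed.

Lemma dot_sum n (a u : 'rV[K]_n) : dot a u = \sum_i a 0 i * u 0 i.
Proof. by rewrite /dot mxE; apply: eq_bigr => i _; rewrite mxE. Qed.

Lemma dot_sym n (a b : 'rV[K]_n) : dot a b = dot b a.
Proof. by rewrite !dot_sum; apply: eq_bigr => i _; rewrite mulrC. Qed.

Lemma dotZl n (c : K) (a b : 'rV[K]_n) : dot (c *: a) b = c * dot a b.
Proof. by rewrite /dot -scalemxAl mxE. Qed.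

Lemma dotBl m (a b v : 'rV[K]_m) : dot (a - b) v = dot a v - dot b v.
Proof. by rewrite /dot mulmxBl mxE [X in _ + X]mxE. Qed.

Lemma dot_suml m (I : Type) (s : seq I) (G : I -> 'rV[K]_m) v :
  dot (\sum_(i <- s) G i) v = \sum_(i <- s) dot (G i) v.
Proof. by rewrite /dot mulmx_suml summxE. Qed.

Lemma dot_mulr m k (b : 'rV[K]_m) (P : 'M[K]_(m, k)) (w : 'rV[K]_k) :
  dot (b *m P) w = dot b (w *m P^T).
Proof. by rewrite /dot trmx_mul trmxK mulmxA. Qed.

Lemma dot_ext m (v w : 'rV[K]_m) : (forall b : 'rV[K]_m, dot b v = dot b w) -> v = w.
Proof.
move=> h; apply/rowP => i; have := h (delta_mx 0 i).
by rewrite /dot -!rowE !mxE.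
Qed.

Lemma mul_proj n (u a b : 'rV[K]_n) : b *m proj u a = b - dot b u *: a.
Proof. by rewrite mulmxBr mulmx1 mulmxA dotE mul_scalar_mx. Qed.

Lemma proj_id n (u a : 'rV[K]_n) : dot a u = 1 -> a *m proj u a = 0.
Proof. by move=> h; rewrite mul_proj h scale1r subrr. Qed.

(** A variable moves by a multiple of [lin a], and congruence modulo [lin a] passes to sums and
    products. *)
Lemma lsub_proj_sub n (u a : 'rV[K]_n) p : pdvd (lin a) (p - lsub (proj u a) p).
Proof.
elim/mpoly_rmorph_ind: p => [c|i|p q e1 e2|p q e1 e2].
- by rewrite lsubC subrr; apply: pdvd0.
- rewrite lsubX rowE mul_proj raddfB /= lin_delta opprB addrC subrK linearZ /=.
  by exists (dot (delta_mx 0 i) u)%:MP; rewrite mulrC mul_mpolyC.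
- by rewrite rmorphD opprD addrACA; apply: pdvd_add.
- rewrite rmorphM /=.
  have -> : p * q - lsub (proj u a) p * lsub (proj u a) q
    = (p - lsub (proj u a) p) * q + lsub (proj u a) p * (q - lsub (proj u a) q) by ring.
  by apply: pdvd_add; [apply: pdvd_mulr | apply: pdvd_mull].
Qed.

(** Divisibility by [lin a] becomes membership in the kernel of a ring morphism; primality of linear
    forms and the determinant arguments rest on this. *)
Lemma lsub_proj_eq0 n (u a : 'rV[K]_n) p : dot a u = 1 ->
  lsub (proj u a) p = 0 <-> pdvd (lin a) p.
Proof.
move=> h; split=> [e|[r ->]].
  by have := lsub_proj_sub u a p; rewrite e subr0.
by rewrite rmorphM /= lsub_lin proj_id // raddf0 mul0r.
Qed.

Lemma exists_dual n (a : 'rV[K]_n) : a != 0 -> exists u, dot a u = 1.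
Proof.
move=> /rV0Pn [i hi]; exists ((a 0 i)^-1 *: delta_mx 0 i).
rewrite dot_sum (bigD1 i) //= !mxE !eqxx mulr1 divff // big1 ?addr0 // => j /negPf h.
by rewrite !mxE h andbF !mulr0.
Qed.

Lemma lin_prime n (a : 'rV[K]_n) p q : a != 0 ->
  pdvd (lin a) (p * q) -> pdvd (lin a) p \/ pdvd (lin a) q.
Proof.
move=> /exists_dual [u hu]; rewrite -!(lsub_proj_eq0 _ hu) rmorphM /= => /eqP.
by rewrite mulf_eq0 => /orP [] /eqP ->; [left | right].
Qed.

Lemma pdvd_lin n (a b : 'rV[K]_n) : a != 0 -> pdvd (lin a) (lin b) -> (b <= a)%MS.
Proof.
move=> /exists_dual [u hu] /(lsub_proj_eq0 _ hu); rewrite lsub_lin => /eqP.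
rewrite lin_eq0 mul_proj subr_eq0 => /eqP ->; exact: scalemx_sub.
Qed.

End Substitution.

(** * Saito's criterion *)

Lemma det0_mulmx (S : idomainType) n (A : 'M[S]_n) (w : 'cV[S]_n) :
  w != 0 -> A *m w = 0 -> \det A = 0.
Proof.
move=> /cV0Pn [i hi] e; have : (\det A) *: w = 0.
  by rewrite -mul_scalar_mx -mul_adj_mx -mulmxA e mulmx0.
by move=> /colP /(_ i); rewrite !mxE => /eqP; rewrite mulf_eq0 (negPf hi) orbF => /eqP.
Qed.

Section Saito.
Variables (K : fieldType) (n : nat).
Local Notation S := {mpoly K[n]}.
Implicit Types (a b al u : 'rV[K]_n) (th : 'rV[S]_n) (T : 'M[S]_n).
Implicit Types (F : seq 'rV[K]_n).

Definition cst m k (a : 'M[K]_(m, k)) : 'M[S]_(m, k) := map_mx (@mpolyC n K) a.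

(** The value of the derivation with coefficient row [th] on a linear form. The coefficients may lie
    in a ring with another number of variables, as happens after a substitution. *)
Definition app m (th : 'rV[{mpoly K[m]}]_n) a : {mpoly K[m]} :=
  \sum_i a 0 i *: th 0 i.

Lemma app_mx th a : th *m (cst a)^T = (app th a)%:M.
Proof.
rewrite [LHS]mx11_scalar; congr (_%:M); rewrite mxE; apply: eq_bigr => i _.
by rewrite !mxE -mul_mpolyC mulrC.
Qed.

Lemma app_is_linear m (th : 'rV[{mpoly K[m]}]_n) : linear (app th).
Proof.
move=> c a b; rewrite /app scaler_sumr -big_split /=.
by apply: eq_bigr => i _; rewrite !mxE scalerDl scalerA.
Qed.
HB.instance Definition _ m (th : 'rV[{mpoly K[m]}]_n) :=
  GRing.isLinear.Build K 'rV[K]_n {mpoly K[m]} _ (app th) (app_is_linear th).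

Lemma app_scalel p th a : app (p *: th) a = p * app th a.
Proof. by rewrite /app mulr_sumr; apply: eq_bigr => i _; rewrite mxE scalerAr. Qed.

Lemma app_addl th th' a : app (th + th') a = app th a + app th' a.
Proof. by rewrite /app -big_split; apply: eq_bigr => i _; rewrite mxE scalerDr. Qed.

Lemma app_mull (m : nat) (g : 'rV[S]_m) (T : 'M[S]_(m, n)) a :
  app (g *m T) a = \sum_i g 0 i * app (row i T) a.
Proof.
rewrite mulmx_sum_row; elim/big_ind2: _ => [|x1 x2 y1 y2 <- <-|i _].
- by rewrite /app big1 // => i _; rewrite mxE scaler0.
- exact: app_addl.
- exact: app_scalel.
Qed.

Lemma app_cst u a : app (cst u) a = (dot a u)%:MP.
Proof.
rewrite /app dot_sum raddf_sum; apply: eq_bigr => i _.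
by rewrite mxE -mul_mpolyC -mpolyCM.
Qed.

Lemma lsub_app m k (P : 'M[K]_(m, k)) (th : 'rV[{mpoly K[m]}]_n) a :
  lsub P (app th a) = app (map_mx (lsub P) th) a.
Proof.
by rewrite raddf_sum; apply: eq_bigr => i _; rewrite /= linearZ /= mxE.
Qed.

Definition tang F th := forall a, a \in F -> pdvd (lin a) (app th a).

Definition reduced F :=
  [/\ uniq F, 0 \notin F & {in F &, forall a b, (a <= b)%MS -> a = b}].

Lemma submx_sym_rV a b : a != 0 -> (a <= b)%MS -> (b <= a)%MS.
Proof.
move=> ha /sub_rVP [c e]; have c0 : c != 0.
  by apply: contraNneq ha => c0; rewrite e c0 scale0r.
by apply/sub_rVP; exists c^-1; rewrite e scalerA mulVf // scale1r.
Qed.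

Lemma reduced_perm F F' : perm_eq F F' -> reduced F -> reduced F'.
Proof.
move=> e [h1 h2 h3]; split; [by rewrite -(perm_uniq e) | by rewrite -(perm_mem e) |].
by move=> a b; rewrite -!(perm_mem e); apply: h3.
Qed.

Lemma reduced_sub F F' : uniq F' -> {subset F' <= F} -> reduced F -> reduced F'.
Proof.
move=> u s [h1 h2 h3]; split=> //; first by apply: contra h2 => /s.
by move=> a b /s ha /s hb; apply: h3.
Qed.

Lemma lin_dvd_prod a (I : eqType) (s : seq I) (f : I -> 'rV[K]_n) (P : pred I) :
  a != 0 -> pdvd (lin a) (\prod_(i <- s | P i) lin (f i)) ->
  exists i, [/\ i \in s, P i & (f i <= a)%MS].
Proof.
move=> ha; elim: s => [|i s IH].
  rewrite big_nil => h; have [u hu] := exists_dual ha.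
  by move/(lsub_proj_eq0 _ hu): h => /eqP; rewrite rmorph1 oner_eq0.
rewrite big_cons; case: ifP => hi; last first.
  by move=> /IH [j [h1 h2 h3]]; exists j; rewrite inE h1 orbT.
case/(lin_prime ha) => [/(pdvd_lin ha) h|/IH [j [h1 h2 h3]]].
  by exists i; rewrite mem_head.
by exists j; rewrite inE h1 orbT.
Qed.

(** The forms are pairwise non-associated primes, so dividing out the others leaves a quotient that
    [lin a] still divides. *)
Lemma prodlin_pdvd F p : reduced F -> (forall a, a \in F -> pdvd (lin a) p) ->
  pdvd (\prod_(a <- F) lin a) p.
Proof.
elim: F => [|a F IH]; first by rewrite big_nil => *; apply: pdvd1.
move=> red; have [/= /andP [aF uF] z r] := red => h.
have rF : reduced F.
  by apply: (reduced_sub uF _ red) => b hb; rewrite inE hb orbT.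
have a0 : a != 0 by apply: contraNneq z => <-; apply: mem_head.
have [|q eq] := IH rF; first by move=> b hb; apply: h; rewrite inE hb orbT.
have := h a (mem_head _ _); rewrite eq => /(lin_prime a0) [/(lin_dvd_prod a0)|[q' ->]].
  case=> b [hb _ hba]; have e : b = a by apply: r; rewrite ?mem_head // inE hb orbT.
  by rewrite -e hb in aF.
by exists q'; rewrite big_cons; ring.
Qed.

Lemma cst_eq0 m k (a : 'M[K]_(m, k)) : (cst a == 0) = (a == 0).
Proof.
apply/eqP/eqP => [e|->]; last exact: map_mx0.
apply/matrixP => i j; move/matrixP/(_ i j): e; rewrite !mxE => /eqP.
by rewrite mpolyC_eq0 => /eqP.
Qed.

(** Modulo [lin a] the coefficient column of [a] is a nonzero constant vector in the kernel of
    [T]. *)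
Lemma det_tangent T a : a != 0 -> (forall i, pdvd (lin a) (app (row i T) a)) ->
  pdvd (lin a) (\det T).
Proof.
move=> ha h; have [u hu] := exists_dual ha; apply/(lsub_proj_eq0 _ hu).
rewrite -det_map_mx; apply: (@det0_mulmx _ _ _ (cst a)^T).
  by rewrite -trmx0 (inj_eq (@trmx_inj _ _ _)) cst_eq0.
apply/row_matrixP => i; rewrite row_mul row0 -map_row app_mx -lsub_app.
by rewrite (iffRL (lsub_proj_eq0 _ hu) (h i)) raddf0.
Qed.

(** Saito's criterion serves as the working notion of a basis: [saito_free] and [saito_basis] derive
    independence and generation from it. *)
Definition saito F T := [/\ reduced F, forall i, tang F (row i T) &
  exists2 c : K, c != 0 & \det T = c *: \prod_(a <- F) lin a].

Lemma prodlin_neq0 F : 0 \notin F -> \prod_(a <- F) lin a != 0.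
Proof.
rewrite prodf_seq_neq0 => h; apply/allP => a ha /=; rewrite lin_eq0.
by apply: contraNneq h => <-.
Qed.

Lemma saito_det F T : saito F T -> \det T != 0.
Proof.
case=> -[_ z _] _ [c c0 ->].
by rewrite -mul_mpolyC mulf_neq0 ?mpolyC_eq0 ?prodlin_neq0.
Qed.

Lemma saito_free F T (g : 'rV[S]_n) : saito F T -> g *m T = 0 -> g = 0.
Proof.
move=> /saito_det hd e.
have : \det T *: g = 0 by rewrite -mul_mx_scalar -mul_mx_adj mulmxA e mul0mx.
move=> /rowP h; apply/rowP => i; move/(_ i): h; rewrite !mxE => /eqP.
by rewrite mulf_eq0 (negPf hd) /= => /eqP.
Qed.

(* Cramer's rule: every coefficient is the determinant of a matrix whose rows
   are all tangent, hence is divisible by the product of the forms. *)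
Lemma saito_basis F T th : saito F T -> tang F th -> exists g, th = g *m T.
Proof.
move=> hs ht; have [red hT [c c0 ed]] := hs.
set Q := \prod_(a <- F) lin a in ed.
have hQ i : pdvd Q ((th *m \adj T) 0 i).
  pose A := \matrix_(k, j) (if k == i then th 0 j else T k j).
  have -> : (th *m \adj T) 0 i = \det A.
    rewrite (expand_det_row _ i) mxE; apply: eq_bigr => j _.
    rewrite !mxE eqxx; congr (_ * (_ * \det _)).
    by apply/matrixP => k l; rewrite !mxE eq_sym (negPf (neq_lift _ _)).
  apply: prodlin_pdvd => // a ha; apply: det_tangent => [|k].
    by case: red => _ z _; apply: contraNneq z => <-.
  case: (eqVneq k i) => [->|hk].
    have -> : row i A = th by apply/rowP => j; rewrite !mxE eqxx.
    exact: ht.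
  have -> : row k A = row k T by apply/rowP => j; rewrite !mxE (negPf hk).
  exact: hT.
have [h eh] : exists h : 'rV[S]_n, th *m \adj T = Q *: h.
  have /fin_all_exists [h eh] := hQ.
  by exists (\row_i h i); apply/rowP => i; rewrite eh !mxE.
exists (c^-1%:MP *: h); apply/eqP; rewrite -subr_eq0; apply/eqP.
have : \det T *: th = Q *: (h *m T).
  by rewrite -mul_mx_scalar -mul_adj_mx mulmxA eh -scalemxAl.
rewrite ed -mul_mpolyC => e.
have Q0 : Q != 0 by case: red => _ z _; apply: prodlin_neq0.
have e2 : (c%:MP * Q) *: (th - c^-1%:MP *: h *m T) = 0.
  rewrite scalerBr e -!scalemxAl scalerA mulrAC -mpolyCM mulfV //.
  by rewrite mul1r subrr.
apply/rowP => i; move/rowP/(_ i): e2; rewrite !mxE => /eqP.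
by rewrite mulf_eq0 mulf_eq0 mpolyC_eq0 (negPf c0) (negPf Q0) /= => /eqP.
Qed.

End Saito.

(** * Restriction to intersections of hyperplanes *)

(** A greedy choice from the end of the list: an element joins [B] if it is related to a
    representative already chosen, and [R] otherwise. *)
Lemma exists_reps (T : eqType) (e : rel T) (L : seq T) :
  {in L &, forall a b, e a b = e b a} -> uniq L ->
  exists R B, [/\ perm_eq L (R ++ B), {in R &, forall a b, e a b -> a = b} &
    forall b, b \in B -> exists2 r, r \in R & e b r].
Proof.
elim: L => [|a L IH] sym /= => [_|/andP [aL uL]]; first by exists [::], [::].
have [|//|R [B [h1 h2 h3]]] := IH.
  by move=> x y hx hy; apply: sym; rewrite inE ?hx ?hy orbT.
have sub x : x \in R -> x \in a :: L.
  by move=> hx; rewrite inE (perm_mem h1) mem_cat hx orbT.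
case: (boolP (has (e a) R)) => [/hasP [r hr ear]|/hasPn na].
  exists R, (a :: B); split=> //.
    by rewrite perm_sym perm_catC /= perm_cons perm_catC perm_sym.
  by move=> b; rewrite inE => /predU1P [->|/h3 //]; exists r.
exists (a :: R), B; split; first by rewrite /= perm_cons.
- move=> x y; rewrite !inE => /predU1P [->|hx] /predU1P [->|hy] //; last exact: h2.
    by rewrite (negPf (na _ hy)).
  by rewrite (sym _ _ (sub _ hx) (mem_head _ _)) (negPf (na _ hx)).
- by move=> b /h3 [r hr ebr]; exists r; rewrite // inE hr orbT.
Qed.

Section Restriction.
Variables (K : fieldType) (n : nat).
Local Notation S := {mpoly K[n]}.
Implicit Types (a b al u : 'rV[K]_n) (th : 'rV[S]_n) (T : 'M[S]_n).
Implicit Types (F : seq 'rV[K]_n).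

(** The linear factors are primes not dividing [g], so they pass to [h] one by one. Repetitions are
    allowed, since the forms of one class restrict to proportional forms. *)
Lemma prodlin_pdvd_cancel (L : seq 'rV[K]_n) (g h : S) :
  (forall l, l \in L -> l != 0 /\ ~ pdvd (lin l) g) ->
  pdvd (\prod_(l <- L) lin l) (g * h) -> pdvd (\prod_(l <- L) lin l) h.
Proof.
elim: L h => [|l L IH] h hL; first by rewrite big_nil => _; apply: pdvd1.
rewrite big_cons => -[q e]; have [l0 ng] := hL _ (mem_head _ _).
have : pdvd (lin l) (g * h) by rewrite e -mulrA; exists (\prod_(j <- L) lin j * q).
case/(lin_prime l0) => // -[h' eh].
have [q' eq'] : pdvd (\prod_(k <- L) lin k) h'.
  apply: IH => [k hk|]; first by apply: hL; rewrite inE hk orbT.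
  exists q; apply: (@mulfI _ (lin l)); first by rewrite lin_eq0.
  by rewrite mulrCA -eh e mulrA.
by rewrite eh eq'; exists q'; rewrite mulrA.
Qed.

Lemma lin_dvd_bigprod a (I : eqType) (s : seq I) (G : I -> S) :
  a != 0 -> pdvd (lin a) (\prod_(i <- s) G i) ->
  exists2 i, i \in s & pdvd (lin a) (G i).
Proof.
move=> ha; elim: s => [|i s IH]; rewrite ?big_nil ?big_cons.
  move=> h; have [u hu] := exists_dual ha.
  by move/(lsub_proj_eq0 _ hu): h => /eqP; rewrite rmorph1 oner_eq0.
case/(lin_prime ha) => [h|/IH [j h1 h2]]; first by exists i; rewrite ?mem_head.
by exists j; rewrite // inE h1 orbT.
Qed.

Section OneForm.
Variables (F : seq 'rV[K]_n) (al u : 'rV[K]_n).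
Hypothesis redF : reduced F.
Hypothesis alF : forall a, a \in F -> ~~ (a <= al)%MS.
Hypothesis du : dot al u = 1.
Local Notation P := (proj u al).

Lemma proj_neq0 a : a \in F -> a *m P != 0.
Proof.
move=> /alF; apply: contra; rewrite mul_proj subr_eq0 => /eqP ->.
exact: scalemx_sub.
Qed.

(* All members of a class of forms with the same restriction divide
   [al * th r - r * th al], which restricts to [- r * th al]. *)
Lemma class_pdvd th r (B : seq 'rV[K]_n) : tang F th -> uniq (r :: B) ->
  {subset r :: B <= F} -> (forall b, b \in B -> (b *m P <= r *m P)%MS) ->
  pdvd (\prod_(b <- B) lin (b *m P)) (lsub P (app th al)).
Proof.
move=> ht uB sB cB; pose D := lin al * app th r - lin r * app th al.
have [q eD] : pdvd (\prod_(b <- r :: B) lin b) D.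
  apply: prodlin_pdvd; first exact: reduced_sub uB sB redF.
  move=> b hb.
  have [s e] : exists s, b *m P = s *: (r *m P).
    apply/sub_rVP; move: hb; rewrite inE => /predU1P [->|/cB //]; exact: submx_refl.
  have s0 : s != 0.
    by apply: contraNneq (proj_neq0 (sB _ hb)) => s0; rewrite e s0 scale0r.
  (* Proportional restrictions mean that [b] lies in the span of [r] and [al]; substituting this
     makes [D] a visible multiple of [lin b]. *)
  have [t eb] : exists t, b = s *: r + t *: al.
    exists (dot b u - s * dot r u); move: e.
    rewrite !mul_proj => /(canRL (subrK _)) e'.
    by rewrite {1}e' scalerBr scalerA scalerBl addrA [RHS]addrAC.
  have [p ep] := ht _ (sB _ hb).
  suff -> : D = lin b * (s^-1%:MP * (lin al * p - app th al)).
    by exists (s^-1%:MP * (lin al * p - app th al)).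
  have s1 : s^-1%:MP * s%:MP = 1 :> S by rewrite -mpolyCM mulVf.
  have := ep; rewrite {1}eb !linearD !linearZ /= -!mul_mpolyC => ep'.
  have er : app th r = s^-1%:MP * (lin b * p - t%:MP * app th al).
    by rewrite -ep' addrK mulrA s1 mul1r.
  have eb' : lin b = s%:MP * lin r + t%:MP * lin al.
    by rewrite eb linearD !linearZ /= !mul_mpolyC.
  have er' : lin r = s^-1%:MP * (lin b - t%:MP * lin al).
    by rewrite eb' addrK mulrA s1 mul1r.
  by rewrite /D er er'; ring.
have r0 : lin (r *m P) != 0.
  by rewrite lin_eq0 proj_neq0 // sB ?mem_head.
(* Both sides of the restricted identity contain [lin (r *m P)]; cancelling it leaves the product
   over [B] alone. *)
exists (- lsub P q); apply: (mulfI r0).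
move: (congr1 (lsub P) eD); rewrite /D big_cons rmorphB !rmorphM /= !lsub_lin.
rewrite proj_id // raddf0 mul0r sub0r rmorph_prod /=.
under eq_bigr do rewrite lsub_lin.
by move=> e; apply: (@oppr_inj S); rewrite e; ring.
Qed.

(** [R] keeps one form per hyperplane of the restriction, and the product over the discarded forms
    [B] is Terao's polynomial. Each class contributes a divisor by [class_pdvd], and different
    classes are coprime. *)
Lemma terao_decomp : exists R B, [/\ perm_eq F (R ++ B),
   {in R &, injective (fun r => r *m P)} /\ reduced [seq r *m P | r <- R],
   forall b, b \in B -> exists2 r, r \in R & (b *m P <= r *m P)%MS &
   forall th, tang F th ->
     pdvd (\prod_(b <- B) lin (b *m P)) (lsub P (app th al))].
Proof.
have [uF zF _] := redF.
pose e a b := (a *m P <= b *m P)%MS.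
have [|//|R [B [pe hR hB]]] := @exists_reps _ e F.
  by move=> a b ha hb; apply/idP/idP; apply: submx_sym_rV; apply: proj_neq0.
have sR : {subset R <= F} by move=> x hx; rewrite (perm_mem pe) mem_cat hx.
have sB : {subset B <= F} by move=> x hx; rewrite (perm_mem pe) mem_cat hx orbT.
move: uF; rewrite (perm_uniq pe) cat_uniq => /and3P [uR /hasPn RB uB].
have injR : {in R &, injective (fun r => r *m P)}.
  by move=> a b ha hb eab; apply: hR => //; rewrite /e eab submx_refl.
exists R, B; split=> //; [split=> // | ].
  split; first by rewrite map_inj_in_uniq.
    by apply/mapP => -[r /sR /proj_neq0 h1 h2]; rewrite -h2 eqxx in h1.
  by move=> _ _ /mapP [a ha ->] /mapP [b hb ->] h; rewrite (hR a b).
move=> th ht; set f := lsub P _.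
pose H r := \prod_(b <- B | e b r) lin (b *m P).
have hH r : r \in R -> pdvd (H r) f.
  move=> hr; rewrite /H -big_filter; apply: (@class_pdvd _ r) => //.
  - rewrite /= filter_uniq // andbT mem_filter negb_and.
    by apply/orP; right; apply/negP => /RB; rewrite hr.
  - by move=> x; rewrite inE mem_filter => /predU1P [->|/andP [_ /sB]] //; apply: sR.
  - by move=> b; rewrite mem_filter => /andP [].
have hall R0 : uniq R0 -> {subset R0 <= R} -> pdvd (\prod_(r <- R0) H r) f.
  elim: R0 => [|r R0 IH] /= => [_ _|/andP [rR0 uR0] sub].
    by rewrite big_nil; apply: pdvd1.
  have [|h eh] := IH uR0; first by move=> x hx; apply: sub; rewrite inE hx orbT.
  have rR : r \in R by apply: sub; apply: mem_head.
  (* No factor of [H r] divides the product over [R0]: a common factor would make two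
     representatives equivalent. *)
  have : pdvd (H r) h.
    have := hH r rR; rewrite eh /H -big_filter.
    rewrite -(big_map (fun b => b *m P) xpredT (@lin K n)).
    apply: prodlin_pdvd_cancel => l /mapP [b]; rewrite mem_filter => /andP [ebr bB] ->.
    have b0 := proj_neq0 (sB _ bB); split=> // /(lin_dvd_bigprod b0).
    case=> r' r'R0 /(lin_dvd_prod b0) [b' [b'B eb' hb']].
    have r'R : r' \in R by apply: sub; rewrite inE r'R0 orbT.
    suff e' : r' = r by rewrite -e' r'R0 in rR0.
    apply: hR => //; apply: submx_trans ebr; apply: submx_trans hb'.
    by apply: submx_sym_rV eb'; apply: proj_neq0; apply: sB.
  case=> h' eh'; rewrite big_cons eh eh'; exists h'; ring.
suff -> : \prod_(b <- B) lin (b *m P) = \prod_(r <- R) H r by apply: hall.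
rewrite /H (exchange_big_dep xpredT) //=; apply: eq_big_seq => b bB.
have [r rR ebr] := hB b bB.
rewrite big_mkcond (bigD1_seq r) //= ebr big1_seq ?mulr1 // => r' /andP [rr' r'R].
case: ifP => // ebr'; case/eqP: rr'; apply: hR => //.
by apply: submx_trans ebr; apply: submx_sym_rV ebr'; apply: proj_neq0; apply: sB.
Qed.
End OneForm.
End Restriction.

Section Restrict.
Variables (K : fieldType) (n : nat).
Local Notation S := {mpoly K[n]}.
Implicit Types (a b al u v : 'rV[K]_n) (th : 'rV[S]_n) (T : 'M[S]_n).
Implicit Types (F : seq 'rV[K]_n).

Lemma mpoly_mul_const (p q : S) (c : K) : c != 0 -> p * q = c%:MP ->
  exists2 d, d != 0 & p = d%:MP.
Proof.
move=> c0 e; have h : p * q != 0 by rewrite e mpolyC_eq0.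
have p0 : p != 0 by apply: contraNneq h => ->; rewrite mul0r.
have q0 : q != 0 by apply: contraNneq h => ->; rewrite mulr0.
apply/msize_poly1P; move: (msizeM p0 q0); rewrite e msizeC c0.
move: p0 q0; rewrite -!msize_poly_eq0.
by case: (msize p) (msize q) => [|[|k]] [|l] //=; rewrite ?addnS ?addSn.
Qed.

Lemma lsub_cst m k l (P : 'M[K]_(n, l)) (a : 'M[K]_(m, k)) :
  map_mx (lsub P) (cst n a) = cst l a.
Proof. by apply/matrixP => i j; rewrite !mxE lsubC. Qed.

(** Multiplying [T] by the column of [al] leaves only the entry [f] in row [y]. Subtracting
    [f *: cst n u] from that row makes the column a kernel vector, so by multilinearity only [f]
    times the determinant with the constant row remains. *)
Lemma det_restrict T y al u (f : S) : al != 0 -> dot al u = 1 ->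
  (forall i, app (row i T) al = f *+ (i == y)) ->
  \det T = f * \det (\matrix_i (if i == y then cst n u else row i T)).
Proof.
move=> al0 du h; set N := \matrix_i _.
pose C := \matrix_i (if i == y then row i T - f *: cst n u else row i T).
rewrite (@determinant_multilinear _ _ T N C y f 1).
- suff -> : \det C = 0 by rewrite mulr0 addr0.
  apply: (@det0_mulmx _ _ _ (cst n al)^T).
    by rewrite -trmx0 (inj_eq (@trmx_inj _ _ _)) cst_eq0.
  apply/row_matrixP => i; rewrite row_mul row0 rowK; case: eqP => [->|/eqP /negPf hi].
    rewrite mulmxBl -scalemxAl !app_mx h eqxx app_cst du.
    by rewrite scale_scalar_mx mulr1n mulr1 subrr.
  by rewrite app_mx h hi raddf0.
- by rewrite !rowK eqxx scale1r addrC subrK.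
- by apply/matrixP => i k; rewrite !mxE eq_sym (negPf (neq_lift _ _)) mxE.
- by apply/matrixP => i k; rewrite !mxE eq_sym (negPf (neq_lift _ _)) mxE.
Qed.

(* The determinant restricted to [al = 0] is [f * \det N], where [f] restricts
   [T_y al]; Terao's polynomial divides [f] and the restricted forms divide
   [\det N], so both divisions are exact up to constants. *)
Lemma saito_restrict F T y al u :
  let P := proj u al in
  let N := \matrix_i (if i == y then cst n u else map_mx (lsub P) (row i T)) in
  saito F T -> (forall a, a \in F -> ~~ (a <= al)%MS) -> dot al u = 1 ->
  (forall i, i != y -> pdvd (lin al) (app (row i T) al)) ->
  exists2 F', saito F' N & {subset F' <= [seq a *m P | a <- F]}.
Proof.
move=> P N hs alF du hT; have [red tT [c c0 ed]] := hs.
have al0 : al != 0.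
  apply: contra_eq_neq du => ->; rewrite /dot mul0mx mxE eq_sym; exact: oner_neq0.
(* Every restricted form vanishes on [u], so the new constant row is tangent to all of them. *)
have uP a : dot (a *m P) u = 0.
  by rewrite mul_proj /dot mulmxBl -scalemxAl !dotE du !mxE mulr1 subrr.
have hN a : (forall i, pdvd (lin a) (app (row i T) a)) ->
  forall i, pdvd (lin (a *m P)) (app (row i N) (a *m P)).
  move=> ha i; rewrite rowK; case: eqP => [_|/eqP hi].
    by rewrite app_cst uP raddf0; apply: pdvd0.
  have -> : app (map_mx (lsub P) (row i T)) (a *m P) = lsub P (app (row i T) a).
    rewrite mul_proj linearB linearZ /= -!lsub_app.
    by rewrite (iffRL (lsub_proj_eq0 _ du) (hT i hi)) scaler0 subr0.
  by rewrite -lsub_lin; apply: lsub_pdvd.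
have [R [B [pe [injR redR] _ hB]]] := terao_decomp red alF du.
pose f := lsub P (app (row y T) al).
have hf : lsub P (\det T) = f * \det N.
  rewrite -det_map_mx (@det_restrict _ y al u f al0 du).
    congr (_ * \det _); apply/row_matrixP => i.
    by rewrite !rowK; case: ifP => // _; rewrite map_row.
  move=> i; rewrite -map_row -lsub_app; case: eqP => [->|/eqP hi] //.
  by rewrite mulr0n (iffRL (lsub_proj_eq0 _ du) (hT i hi)).
have sR a : a \in [seq r *m P | r <- R] -> exists2 b, b \in F & a = b *m P.
  by case/mapP => b hb ->; exists b; rewrite // (perm_mem pe) mem_cat hb.
exists [seq r *m P | r <- R]; last first.
  by move=> a /sR [b hb ->]; apply: map_f.
split=> // [i a /sR [b hb ->]|].
  by apply: hN => j; apply: tT.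
have [g eg] : pdvd (\prod_(a <- [seq r *m P | r <- R]) lin a) (\det N).
  apply: prodlin_pdvd => // a ha; apply: det_tangent => [|i].
    by case: redR => _ z _; apply: contraNneq z => <-.
  by have [b hb ->] := sR a ha; apply: hN => j; apply: tT.
have [h eh] := hB _ (tT y).
have e2 : h * g = c%:MP.
  move: hf; rewrite ed -mul_mpolyC rmorphM /= lsubC (perm_big _ pe) big_cat /=.
  rewrite rmorphM !rmorph_prod /=; under eq_bigr do rewrite lsub_lin.
  under [X in c%:MP * (_ * X)]eq_bigr do rewrite lsub_lin.
  rewrite /f eh eg big_map; move=> e.
  pose Q1 := \prod_(r <- R) lin (r *m P); pose Q2 := \prod_(b <- B) lin (b *m P).
  rewrite -/Q1 -/Q2 in e.
  have Q10 : Q1 != 0.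
    by rewrite /Q1 -(big_map (fun r => r *m P) xpredT (@lin K n)) prodlin_neq0 //; case: redR.
  have Q20 : Q2 != 0.
    rewrite /Q2 -(big_map (fun r => r *m P) xpredT (@lin K n)) prodlin_neq0 //.
    apply/mapP => -[b bB] e0; have := @proj_neq0 _ _ F al u alF b.
    by rewrite -e0 eqxx (perm_mem pe) mem_cat bB orbT => /(_ isT).
  apply: (mulfI (mulf_neq0 Q10 Q20)); rewrite [RHS]mulrC e; ring.
rewrite mulrC in e2; have [d d0 ed'] := mpoly_mul_const c0 e2.
by exists d; rewrite // eg ed' mulrC mul_mpolyC.
Qed.

(* The forms [a *m mproj al u Y] model the restriction to the intersection [X] of
   the hyperplanes [al y = 0] times the empty arrangement in the directions [u y],
   which account for the constant rows; all restrictions thus live in one ring. *)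
Definition mproj (al u : 'I_n -> 'rV[K]_n) (Y : seq 'I_n) : 'M[K]_n :=
  1%:M - \sum_(y <- Y) (u y)^T *m al y.

Definition mrestr (al u : 'I_n -> 'rV[K]_n) (Y : seq 'I_n) T : 'M[S]_n :=
  \matrix_i (if i \in Y then cst n (u i)
             else map_mx (lsub (mproj al u Y)) (row i T)).

Lemma row_mrestr (al u : 'I_n -> 'rV[K]_n) (Y : seq 'I_n) T i :
  row i (mrestr al u Y T) = if i \in Y then cst n (u i)
    else map_mx (lsub (mproj al u Y)) (row i T).
Proof. exact: rowK. Qed.

Lemma map_lsub_comp m k l r (P : 'M[K]_(n, l)) (Q : 'M[K]_(l, r)) (A : 'M[S]_(m, k)) :
  map_mx (lsub Q) (map_mx (lsub P) A) = map_mx (lsub (P *m Q)) A.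
Proof. by apply/matrixP => i j; rewrite !mxE lsub_comp. Qed.

Lemma mul_mproj (al u : 'I_n -> 'rV[K]_n) Y a :
  a *m mproj al u Y = a - \sum_(y <- Y) dot a (u y) *: al y.
Proof.
rewrite mulmxBr mulmx1 mulmx_sumr; congr (_ - _); apply: eq_bigr => y _.
by rewrite mulmxA dotE mul_scalar_mx.
Qed.

Section Multi.
Variables (al u : 'I_n -> 'rV[K]_n).

Lemma mproj_id Y a : (forall z, z \in Y -> dot a (u z) = 0) ->
  a *m mproj al u Y = a.
Proof.
move=> h; rewrite mul_mproj big1_seq ?subr0 // => z /andP [_ /h ->].
by rewrite scale0r.
Qed.

Lemma mproj_kill Y y : uniq Y -> y \in Y ->
  {in Y, forall z, dot (al y) (u z) = (y == z)%:R} -> al y *m mproj al u Y = 0.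
Proof.
move=> uY hy h; rewrite mul_mproj (bigD1_seq y) //= h // eqxx scale1r.
rewrite big1_seq ?addr0 ?subrr // => z /andP [zy hz].
by rewrite h // eq_sym (negPf zy) scale0r.
Qed.

Lemma dot_mproj Y a v : (forall y, y \in Y -> dot (al y) v = 0) ->
  dot (a *m mproj al u Y) v = dot a v.
Proof.
move=> h; rewrite mul_mproj /dot mulmxBl mulmx_suml [X in _ - X]big1_seq ?subr0 //.
by move=> y /andP [_ hy]; rewrite -scalemxAl (dotE (al y)) h // scale_scalar_mx mulr0 raddf0.
Qed.

Lemma mproj_cons Y y : {in Y, forall z, dot (al z) (u y) = 0} ->
  mproj al u Y *m proj (u y) (al y) = mproj al u (y :: Y).
Proof.
move=> h; rewrite /mproj big_cons /proj mulmxBr mulmx1 mulmxBl mul1mx.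
rewrite mulmx_suml [X in _ - (_ - X)]big1_seq ?subr0; first by rewrite opprD addrA addrAC.
move=> z /andP [_ hz]; rewrite -mulmxA (mulmxA (al z)) dotE h //.
by rewrite mul_scalar_mx scale0r mulmx0.
Qed.

(** The hyperplanes are restricted one at a time: by duality each [al y] is fixed by the earlier
    projections, and these compose to [mproj]. The point [v] lies on all of them and off [F], so no
    restricted form becomes a multiple of the next [al y]. *)
Lemma saito_mrestr F T v Y : saito F T -> uniq Y ->
  {in Y &, forall y z, dot (al y) (u z) = (y == z)%:R} ->
  (forall y, y \in Y -> dot (al y) v = 0) ->
  (forall a, a \in F -> dot a v != 0) ->
  (forall y i, y \in Y -> i != y -> pdvd (lin (al y)) (app (row i T) (al y))) ->
  let P := mproj al u Y in
  let N := mrestr al u Y T in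
  exists2 F', saito F' N & {subset F' <= [seq a *m P | a <- F]}.
Proof.
move=> hs; elim: Y => [|y Y IH] /=.
  move=> _ _ _ _ _; have -> : mrestr al u [::] T = T.
    apply/row_matrixP => i; rewrite rowK /=.
    by apply/matrixP => j k; rewrite /mproj big_nil subr0 !mxE lsub1.
  rewrite /mproj big_nil subr0.
  by exists F => // a ha; apply/mapP; exists a; rewrite // mulmx1.
move=> /andP [yY uY] dual av Fv hT.
have sub z : z \in Y -> z \in y :: Y by move=> h; rewrite inE h orbT.
have [F1 s1 sub1] : exists2 F', saito F' (mrestr al u Y T) &
    {subset F' <= [seq a *m mproj al u Y | a <- F]}.
  by apply: IH => // [x z hx hz|x hx|x i hx];
    [apply: dual; apply: sub | apply: av; apply: sub | apply: hT; apply: sub].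
have yh := mem_head y Y.
have ne z : z \in Y -> (y == z) = false by move=> hz; apply: contraNF yY => /eqP ->.
have duy : dot (al y) (u y) = 1 by rewrite (dual _ _ yh yh) eqxx.
have aly : al y *m mproj al u Y = al y.
  by apply: mproj_id => z hz; rewrite (dual _ _ yh (sub _ hz)) ne.
have F1y a : a \in F1 -> ~~ (a <= al y)%MS.
  move=> /sub1 /mapP [b hb ->]; apply/negP => /sub_rVP [c e].
  have := Fv b hb; rewrite -(@dot_mproj Y b v); last by move=> z hz; apply: av; apply: sub.
  by rewrite e /dot -scalemxAl dotE av // !mxE mul0rn mulr0 eqxx.
have h2 i : i != y -> pdvd (lin (al y)) (app (row i (mrestr al u Y T)) (al y)).
  move=> hi; rewrite rowK; case: ifP => hiY.
    by rewrite app_cst (dual _ _ yh (sub _ hiY)) ne // raddf0; apply: pdvd0.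
  by rewrite -lsub_app -{1}aly -lsub_lin; apply: lsub_pdvd; apply: hT.
have [F2 s2 sub2] := saito_restrict s1 F1y duy h2.
have eP : mproj al u Y *m proj (u y) (al y) = mproj al u (y :: Y).
  by apply: mproj_cons => z hz; rewrite (dual _ _ (sub _ hz) yh) eq_sym ne.
have eN : mrestr al u (y :: Y) T = \matrix_i (if i == y then cst n (u y) else
   map_mx (lsub (proj (u y) (al y))) (row i (mrestr al u Y T))).
  apply/row_matrixP => i; rewrite [RHS]rowK (row_mrestr al u (y :: Y) T i)
    (row_mrestr al u Y T i) in_cons.
  have [->|_] := eqVneq i y; first by [].
  rewrite orFb; case: (i \in Y); first by rewrite lsub_cst.
  by rewrite map_lsub_comp eP.
exists F2; first by rewrite eN.
by move=> a /sub2 /mapP [b /sub1 /mapP [b' hb' ->] ->]; apply/mapP; exists b'; rewrite // -eP mulmxA.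
Qed.

End Multi.
End Restrict.

(** * Multiple addition *)

Section MATstep.
Variables (K : fieldType) (n : nat).
Local Notation S := {mpoly K[n]}.
Implicit Types (a b u v : 'rV[K]_n) (th : 'rV[S]_n) (T U : 'M[S]_n).
Implicit Types (F : seq 'rV[K]_n).

Lemma dhomog_size d (p : S) : p != 0 -> p \is d.-homog -> msize p = d.+1.
Proof.
move=> p0 hp; rewrite (dhomog_uniq p0 hp (dhomog_msize hp)) prednK //.
by rewrite lt0n msize_poly_eq0.
Qed.

Lemma dhomog_bigprod (I : Type) (s : seq I) (G : I -> S) :
  (forall i, G i \is 1.-homog) -> \prod_(i <- s) G i \is (size s).-homog.
Proof.
move=> h; elim: s => [|i s IH]; first by rewrite big_nil dhomog1.
by rewrite big_cons /= -(add1n (size s)); apply: dhomogM.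
Qed.

Lemma lsub_homog l (P : 'M[K]_(n, l)) d (p : S) : p \is d.-homog -> lsub P p \is d.-homog.
Proof.
move=> /dhomogP hp; rewrite (mpolyE p) raddf_sum big_seq; apply: rpred_sum => m hm.
rewrite /= linearZ /=; apply: rpredZ.
rewrite lsubXm -(hp _ hm) /= mdegE.
elim/big_ind2: _ => [|x1 d1 x2 d2 h1 h2|i _]; first exact: dhomog1.
  exact: dhomogM.
have : lin (row i P) ^+ m i \is (1 * m i).-homog by apply: dhomogMn; apply: lin_homog.
by rewrite mul1n.
Qed.

Lemma app_homog m d (th : 'rV[{mpoly K[m]}]_n) a : (forall j, th 0 j \is d.-homog) -> app th a \is d.-homog.
Proof. by move=> h; apply: rpred_sum => i _; apply/rpredZ/h. Qed.

(** Degrees add, so a nonzero [h] is constant and forces [d = k]; for [d < k] the quotient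
    vanishes. *)
Lemma homog_quotient d k (B h : S) : B != 0 -> B \is k.-homog -> (d <= k)%N ->
  B * h \is d.-homog -> exists2 c : K, B * h = c *: B & (c != 0 -> d = k).
Proof.
move=> B0 hB dk hBh; have [h0|h0] := eqVneq h 0.
  by exists 0; rewrite ?eqxx // h0 mulr0 scale0r.
have := msizeM B0 h0; rewrite (dhomog_size B0 hB) (dhomog_size _ hBh) ?mulf_neq0 //.
move=> e; have h1 : msize h != 0%N by rewrite msize_poly_eq0.
have [c c0 ->] : exists2 c, c != 0 & h = c%:MP.
  by apply/msize_poly1P; move: (msize h) e h1 => s e h1; apply/eqP; lia.
exists c; first by rewrite mulrC mul_mpolyC.
by move=> _; move: (msize h) e h1 => s e h1; lia.
Qed.

Lemma meval_app T i a v :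
  (app (row i T) a).@[fun j => v 0 j] =
  (map_mx (meval (fun j => v 0 j)) T *m a^T) i 0.
Proof.
rewrite /app raddf_sum mxE; apply: eq_bigr => j _.
by rewrite /= mevalZ !mxE mulrC.
Qed.

(* The size of Terao's polynomial [\prod_(b <- B) lin b] is the number of forms
   lost when [F] is restricted to the hyperplane [al = 0]. *)
Definition restr_defect F al u k := forall R B,
  perm_eq F (R ++ B) -> {in R &, injective (fun r => r *m proj u al)} ->
  reduced [seq r *m proj u al | r <- R] ->
  (forall b, b \in B ->
     exists2 r, r \in R & (b *m proj u al <= r *m proj u al)%MS) ->
  size B = k.

(** The product comes from [terao_decomp]. A form and its restriction agree on [al = 0], so at [v]
    every factor keeps its nonzero value. *)
Lemma terao_poly F al u v k : reduced F -> dot al u = 1 -> dot al v = 0 ->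
  (forall a, a \in F -> dot a v != 0) -> restr_defect F al u k ->
  exists B : S, [/\ B \is k.-homog, B.@[fun j => v 0 j] != 0 &
    forall th, tang F th -> pdvd B (lsub (proj u al) (app th al))].
Proof.
move=> red du av Fv cnt.
have alF a : a \in F -> ~~ (a <= al)%MS.
  move=> /Fv; apply: contra => /sub_rVP [c ->].
  by rewrite /dot -scalemxAl dotE av mxE mxE mul0rn mulr0.
have [R [B [pe [inj redR] cls hB]]] := terao_decomp red alF du.
exists (\prod_(b <- B) lin (b *m proj u al)); split=> //.
  rewrite -(cnt _ _ pe inj redR cls); apply: dhomog_bigprod => i; exact: lin_homog.
rewrite rmorph_prod /= prodf_seq_neq0; apply/allP => b hb /=.
rewrite meval_lin -dot_sum mul_proj /dot mulmxBl -scalemxAl !dotE av.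
rewrite scale_scalar_mx mulr0 raddf0 subr0 -dotE; apply: Fv.
by rewrite (perm_mem pe) mem_cat hb orbT.
Qed.

(* Evaluating at a point of all the new hyperplanes and of none of the old ones
   shows that the constant matrix of the [T_i (al t)] modulo [al t] has full rank. *)
Lemma mat_matrix F T (e : 'I_n -> nat) k q (al u : 'I_q -> 'rV[K]_n) v :
  saito F T -> (forall i j, T i j \is (e i).-homog) -> (forall i, e i <= k)%N ->
  (forall t s, dot (al t) (u s) = (t == s)%:R) -> (forall t, dot (al t) v = 0) ->
  (forall a, a \in F -> dot a v != 0) ->
  (forall t, restr_defect F (al t) (u t) k) ->
  exists (C : 'M[K]_(n, q)) (B : 'I_q -> S), [/\ row_full C,
    forall i t, C i t != 0 -> e i = k &
    forall i t, lsub (proj (u t) (al t)) (app (row i T) (al t)) = C i t *: B t].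
Proof.
move=> hs hom ek dual av Fv cnt; have [red tT _] := hs.
have du t : dot (al t) (u t) = 1 by rewrite dual eqxx.
have /fin_all_exists [B hB] t := terao_poly red (du t) (av t) Fv (cnt t).
have hC i t : exists c : K, lsub (proj (u t) (al t)) (app (row i T) (al t)) = c *: B t
    /\ (c != 0 -> e i = k).
  have [h1 h2 h3] := hB t; have [h eh] := h3 _ (tT i).
  have [||c e1 e2] := homog_quotient (d := e i) (h := h) _ h1 (ek i).
  - by apply: contraNneq h2 => ->; rewrite meval0.
  - rewrite -eh; apply: lsub_homog; apply: app_homog => j; rewrite mxE; exact: hom.
  by exists c; rewrite eh.
have /fin_all_exists [C0 hC0] i := fin_all_exists (hC i).
exists (\matrix_(i, t) C0 i t), B; split; last 2 first.
- by move=> i t; rewrite mxE; apply: (hC0 i t).2.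
- by move=> i t; rewrite mxE; apply: (hC0 i t).1.
pose Tv := map_mx (meval (fun j => v 0 j)) T.
have uTv : Tv \in unitmx.
  rewrite unitmxE unitfE det_map_mx; case: hs => _ _ [c c0 ->].
  rewrite /= mevalZ mulf_neq0 // rmorph_prod prodf_seq_neq0; apply/allP => a ha /=.
  by rewrite meval_lin -dot_sum Fv.
pose A : 'M[K]_(q, n) := \matrix_t al t.
pose Um : 'M[K]_(q, n) := \matrix_t u t.
have UA : Um *m A^T = 1%:M.
  apply/matrixP => s t; rewrite !mxE eq_sym -dual dot_sum.
  by apply: eq_bigr => j _; rewrite !mxE mulrC.
have bv t : (B t).@[fun j => v 0 j] != 0 by case: (hB t).
have eC : Tv *m A^T = (\matrix_(i, t) C0 i t) *m diag_mx (\row_t (B t).@[fun j => v 0 j]).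
  apply/matrixP => i t; rewrite mul_mx_diag !mxE.
  have := congr1 (meval (fun j => v 0 j)) (hC0 i t).1; rewrite mevalZ => <-.
  (* As [al t] vanishes at [v], the projection fixes [v] and the substitution does not change the
     value there. *)
  rewrite meval_lsub (meval_eq _ (v2 := fun j => v 0 j)).
    by rewrite meval_app mxE; apply: eq_bigr => j _; rewrite !mxE.
  move=> j; rewrite /proj linearB /= trmx1 mulmxBr mulmx1 trmx_mul trmxK mulmxA.
  by rewrite dotE dot_sym av mul_scalar_mx scale0r subr0.
apply/row_fullP.
(* A left inverse read off from [eC]: [Tv] is invertible by Saito's determinant, [Um] inverts [A^T],
   and the diagonal entries are nonzero. *)
exists (diag_mx (\row_t (B t).@[fun j => v 0 j]) *m Um *m invmx Tv).
have e1 : \matrix_(i, t) C0 i t =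
    Tv *m A^T *m diag_mx (\row_t ((B t).@[fun j => v 0 j])^-1).
  rewrite eC -mulmxA mulmx_diag; apply/matrixP => i t.
  by rewrite mul_mx_diag !mxE divff // mulr1.
rewrite e1 -!mulmxA (mulmxA (invmx Tv)) mulVmx // mul1mx (mulmxA Um) UA mul1mx.
rewrite mulmx_diag; apply/matrixP => s t; rewrite !mxE divff //.
Qed.

Lemma row_full_choose q (C : 'M[K]_(n, q)) : row_full C ->
  exists f : 'I_q -> 'I_n, injective f /\ rowsub f C \in unitmx.
Proof.
move=> h; exists (fullrankfun h); split; first exact: fullrankfun_inj.
by rewrite -row_full_unit fullrowsub_full.
Qed.

(** Gaussian elimination written as one matrix. By the last clause, rows outside [codom f] on which
    [C] vanishes stay unchanged; this keeps basis elements of smaller degree intact. *)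
Lemma row_op_unit q (C : 'M[K]_(n, q)) (f : 'I_q -> 'I_n) : injective f ->
  rowsub f C \in unitmx ->
  exists (W : 'M[K]_n) (G : 'M[K]_(n, q)), [/\ W \in unitmx,
    forall i t, (W *m C) i t = (i == f t)%:R,
    forall i, i \notin codom f ->
      row i W = delta_mx 0 i - \sum_s G i s *: delta_mx 0 (f s),
    forall t, exists g : 'I_q -> K, row (f t) W = \sum_s g s *: delta_mx 0 (f s) &
    forall i, (forall t, C i t = 0) -> forall s, G i s = 0].
Proof.
move=> injf uC; pose Cf := rowsub f C; pose D : 'M[K]_(q, n) := rowsub f 1%:M.
have DE : D *m D^T = 1%:M.
  apply/matrixP => s t; rewrite !mxE (bigD1 (f s)) //= !mxE eqxx mul1r big1.
    by rewrite addr0 (inj_eq injf) eq_sym.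
  by move=> j hj; rewrite !mxE eq_sym (negPf hj) mul0r.
have DC : D *m C = Cf by rewrite mul_rowsub_mx mul1mx.
pose G := C *m invmx Cf; pose E := D^T *m invmx Cf.
(* The factor [1%:M - G *m D] annihilates [C], and [E *m D] sends it to the identity placed in the
   rows [f t]. *)
pose W := 1%:M - G *m D + E *m D.
have WC : W *m C = D^T.
  rewrite /W mulmxDl mulmxBl mul1mx -!mulmxA DC.
  by rewrite !mulVmx // !mulmx1 subrr add0r.
have hD (M : 'M[K]_(n, q)) i : row i (M *m D) = \sum_s M i s *: delta_mx 0 (f s).
  rewrite row_mul mulmx_sum_row; apply: eq_bigr => s _.
  by rewrite mxE; congr (_ *: _); rewrite -row1; apply/rowP => j; rewrite !mxE.
have rW i : row i W = delta_mx 0 i - \sum_s G i s *: delta_mx 0 (f s)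
    + \sum_s E i s *: delta_mx 0 (f s).
  by rewrite -!hD -row1; apply/rowP => j; rewrite !mxE.
exists W, G; split.
- rewrite -row_free_unit; apply: inj_row_free => r rW0.
  have rD : r *m D^T = 0 by rewrite -WC mulmxA rW0 mul0mx.
  move: rW0; rewrite /W mulmxDr mulmxBr mulmx1 /E !mulmxA rD !mul0mx addr0.
  move/eqP; rewrite subr_eq0 => /eqP er.
  have {}er : r = r *m (G *m D) by rewrite {1}er /G !mulmxA.
  have : r *m D^T = r *m G by rewrite {1}er -!mulmxA DE mulmx1.
  by rewrite rD => e; rewrite er mulmxA -e mul0mx.
- by move=> i t; rewrite WC !mxE eq_sym.
- move=> i hi; rewrite rW [X in _ + X]big1 ?addr0 // => s _.
  rewrite /E mxE big1 ?scale0r // => t _; rewrite !mxE.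
  by case: eqP => [e|_]; rewrite ?mul0r //; case/codomP: hi; exists t.
- move=> t; exists (fun s => E (f t) s); rewrite rW.
  have -> : \sum_s G (f t) s *: delta_mx 0 (f s) = delta_mx 0 (f t) :> 'rV[K]_n.
    have DG : D *m G = 1%:M by rewrite mulmxA DC mulmxV.
    have hG s : G (f t) s = (t == s)%:R.
      by move/matrixP/(_ t s): DG; rewrite mul_rowsub_mx mul1mx !mxE.
    rewrite (bigD1 t) //= hG eqxx scale1r big1 ?addr0 // => s /negPf ts.
    by rewrite hG eq_sym ts scale0r.
  by rewrite subrr add0r.
- by move=> i Ci s; rewrite /G mxE big1 // => t _; rewrite Ci mul0r.
Qed.

(** The new basis is [cst n W *m T], where [W] clears the matrix of [mat_matrix] outside the pivot
    rows. Only rows of degree [k] are combined, so homogeneity survives, and the determinant changes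
    by the constant [\det W]. *)
Lemma mat_adapt F T (e : 'I_n -> nat) k q (al u : 'I_q -> 'rV[K]_n) v :
  saito F T -> (forall i j, T i j \is (e i).-homog) -> (forall i, e i <= k)%N ->
  (forall t s, dot (al t) (u s) = (t == s)%:R) -> (forall t, dot (al t) v = 0) ->
  (forall a, a \in F -> dot a v != 0) ->
  (forall t, restr_defect F (al t) (u t) k) ->
  exists (f : 'I_q -> 'I_n) (U : 'M[S]_n) (G : 'M[K]_(n, q)), [/\ injective f,
    forall t, e (f t) = k,
    saito F U /\ (forall i j, U i j \is (e i).-homog),
    forall i, i \notin codom f ->
      row i U = row i T - \sum_s (G i s)%:MP *: row (f s) T /\
      (e i != k -> row i U = row i T) &
    forall t i, i != f t -> pdvd (lin (al t)) (app (row i U) (al t))].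
Proof.
move=> hs hom ek dual av Fv cnt; have [red tT [c c0 ed]] := hs.
have [C [B [fC Ck hC]]] := mat_matrix hs hom ek dual av Fv cnt.
have [f [injf uf]] := row_full_choose fC.
have [W [G [uW WC Wout Win G0]]] := row_op_unit injf uf.
have fk t : e (f t) = k.
  have /rV0Pn [s hs0] : row t (rowsub f C) != 0.
    apply: contraTneq uf => r0; rewrite -row_free_unit -kermx_eq0; apply/rowV0Pn.
    exists (delta_mx 0 t); first by apply/sub_kermxP; rewrite -rowE.
    by apply/rV0Pn; exists t; rewrite mxE !eqxx oner_neq0.
  by apply: (@Ck _ s); move: hs0; rewrite !mxE.
have Gk i s : e i != k -> G i s = 0.
  by move=> hi; apply: G0 => t; apply: contraNeq hi => /Ck ->.
have rU i : row i (cst n W *m T) = \sum_j (W i j)%:MP *: row j T.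
  by rewrite row_mul mulmx_sum_row; apply: eq_bigr => j _; rewrite !mxE.
have lincomb (r : 'rV[K]_n) (i : 'I_n) (g : 'I_q -> K) :
  row i W = r + \sum_s g s *: delta_mx 0 (f s) ->
  row i (cst n W *m T) = \sum_j (r 0 j)%:MP *: row j T + \sum_s (g s)%:MP *: row (f s) T.
  move=> e1; rewrite rU.
  have Wij j : W i j = r 0 j + \sum_s g s * (j == f s)%:R.
    move/rowP/(_ j): e1; rewrite !mxE summxE => ->; congr (_ + _).
    by apply: eq_bigr => s _; rewrite !mxE eqxx.
  under eq_bigr do rewrite Wij mpolyCD scalerDl raddf_sum /= scaler_suml.
  rewrite big_split exchange_big /=; congr (_ + _); apply: eq_bigr => s _.
  rewrite (bigD1 (f s)) //= eqxx mulr1 big1 ?addr0 // => j /negPf ->.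
  by rewrite mulr0 mpolyC0 scale0r.
have rdelta i : \sum_j ((delta_mx 0 i : 'rV[K]_n) 0 j)%:MP *: row j T = row i T.
  rewrite (bigD1 i) //= mxE !eqxx mpolyC1 scale1r big1 ?addr0 // => j /negPf h.
  by rewrite mxE h andbF mpolyC0 scale0r.
have rout i : i \notin codom f ->
    row i (cst n W *m T) = row i T - \sum_s (G i s)%:MP *: row (f s) T.
  move=> hi; rewrite (lincomb (delta_mx 0 i) i (fun s => - G i s)).
    rewrite rdelta -sumrN; congr (_ + _); apply: eq_bigr => s _.
    by rewrite mpolyCN scaleNr.
  by rewrite Wout // -sumrN; congr (_ + _); apply: eq_bigr => s _; rewrite scaleNr.
have rout' i : i \notin codom f -> e i != k -> row i (cst n W *m T) = row i T.
  move=> hi ei; rewrite rout // big1 ?subr0 // => s _.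
  by rewrite Gk // mpolyC0 scale0r.
have rin t : exists g : 'I_q -> K,
    row (f t) (cst n W *m T) = \sum_s (g s)%:MP *: row (f s) T.
  have [g eg] := Win t; exists g; rewrite (lincomb 0 (f t) g) ?add0r //.
  by rewrite big1 ?add0r // => j _; rewrite mxE mpolyC0 scale0r.
exists f, (cst n W *m T), G.
split; [by [] | exact: fk | | by move=> i hi; split; [exact: rout | exact: rout'] | ]; last first.
- move=> t i hi; have dt : dot (al t) (u t) = 1 by rewrite dual eqxx.
  apply/(lsub_proj_eq0 _ dt); rewrite row_mul app_mull raddf_sum /=.
  under eq_bigr do rewrite rmorphM /= hC !mxE lsubC mul_mpolyC scalerA.
  rewrite -scaler_suml; suff -> : \sum_j W i j * C j t = 0 by rewrite scale0r.
  by have := WC i t; rewrite mxE (negPf hi).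
- split.
    split=> // [i a ha|].
      rewrite row_mul app_mull; apply: pdvd_sum => j _; apply: pdvd_mull; exact: tT.
    exists (\det W * c); first by rewrite mulf_neq0 // -unitfE -unitmxE.
    by rewrite det_mulmx det_map_mx ed -scalerA mul_mpolyC.
  move=> i j; have -> : (cst n W *m T) i j = row i (cst n W *m T) 0 j.
    by rewrite [RHS]mxE.
  have homsum m (g : 'I_q -> K) : m = k ->
      (\sum_s (g s)%:MP *: row (f s) T) 0 j \is m.-homog.
    move=> ->; rewrite summxE; apply: rpred_sum => s _.
    by rewrite !mxE mul_mpolyC; apply: rpredZ; rewrite -(fk s).
  case: (boolP (i \in codom f)) => [/codomP [t ->]|hi].
    by have [g ->] := rin t; apply: homsum; apply: fk.
  have [ei|ei] := eqVneq (e i) k; last by rewrite rout' // mxE.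
  rewrite rout // mxE [X in _ + X]mxE [X in X - _]mxE.
  by apply: rpredB; [exact: hom | exact: homsum].
Qed.

End MATstep.

(** * The invariant carried from block to block *)

Lemma exists_subset_between (I : finType) (Z X : {set I}) j : Z \subset X -> (#|Z| <= j <= #|X|)%N ->
  exists Y : {set I}, [/\ Z \subset Y, Y \subset X & #|Y| = j].
Proof.
move=> ZX /andP [Zj]; rewrite -(subnKC Zj); elim: (j - #|Z|)%N => [|m IH] h.
  by exists Z; rewrite addn0.
have [|Y [ZY YX cY]] := IH; first by apply: leq_trans h; rewrite addnS.
have [x] : exists x, x \in X :\: Y.
  apply/card_gt0P; rewrite cardsD (setIidPr YX) subn_gt0 cY; apply: leq_trans h.
  by rewrite addnS.
rewrite inE => /andP [xY xX]; exists (x |: Y); split.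
- by apply: subset_trans ZY _; apply: subsetUr.
- by rewrite subUset sub1set xX.
- by rewrite cardsU1 xY cY addnS.
Qed.

Section Invariant.
Variables (K : fieldType) (n : nat).
Local Notation S := {mpoly K[n]}.
Implicit Types (a b v : 'rV[K]_n) (T U N : 'M[S]_n) (F : seq 'rV[K]_n).
Implicit Types (bt us : 'I_n -> 'rV[K]_n) (Y Z : {set 'I_n}) (e : 'I_n -> nat).

Definition dual_on bt us (Y : {set 'I_n}) :=
  {in Y &, forall y z, dot (bt y) (us z) = (y == z)%:R}.

Lemma dual_sub bt us Y Z : Y \subset Z -> dual_on bt us Z -> dual_on bt us Y.
Proof. by move=> /subsetP s d y z /s hy /s hz; apply: d. Qed.

Lemma dual_neq0 bt us Y y : dual_on bt us Y -> y \in Y -> bt y != 0.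
Proof.
move=> d hy; apply: contra_eq_neq (d y y hy hy) => ->.
by rewrite /dot mul0mx mxE eqxx eq_sym oner_neq0.
Qed.

Definition scale_rows bt (Z : {set 'I_n}) N : 'M[S]_n :=
  \matrix_i (if i \in Z then lin (bt i) *: row i N else row i N).

(** Multiplying row [z] by [lin (bt z)] makes it tangent to the one new hyperplane it may miss and
    contributes the missing factor to the determinant. The point [v] separates the new forms from
    [F], and the dual vectors separate them from one another. *)
Lemma saito_scale F N bt us Z v : saito F N ->
  (forall a, a \in F -> dot a v != 0) -> (forall z, z \in Z -> dot (bt z) v = 0) ->
  dual_on bt us Z ->
  (forall z i, z \in Z -> i != z -> pdvd (lin (bt z)) (app (row i N) (bt z))) ->
  saito (F ++ [seq bt z | z <- enum Z]) (scale_rows bt Z N).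
Proof.
move=> [[uF zF rF] tF [c c0 ed]] Fv bv dual hN.
have Fb a z : a \in F -> z \in Z -> ~~ (a <= bt z)%MS.
  move=> /Fv ha hz; apply: contra ha => /sub_rVP [d ->].
  by rewrite dotZl bv // mulr0.
have bF a z : a \in F -> z \in Z -> ~~ (bt z <= a)%MS.
  move=> ha hz; apply: contra (Fb _ _ ha hz); apply: submx_sym_rV.
  exact: dual_neq0 dual hz.
have bb z z' : z \in Z -> z' \in Z -> (bt z <= bt z')%MS -> z = z'.
  move=> hz hz' /sub_rVP [d e]; apply/eqP; move: (dual z z hz hz).
  rewrite e dotZl dual // eqxx eq_sym; case: eqP => // _ /eqP.
  by rewrite mulr0 eq_sym oner_eq0.
split.
- split.
  + rewrite cat_uniq uF map_inj_in_uniq ?enum_uniq; last first.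
      move=> y z; rewrite !mem_enum => hy hz e; apply: bb => //.
      by rewrite e submx_refl.
    rewrite andbT; apply/hasPn => x /mapP [z]; rewrite mem_enum => hz ->.
    by apply/negP => /Fb /(_ hz); rewrite submx_refl.
  + rewrite mem_cat negb_or zF; apply/mapP => -[z]; rewrite mem_enum => hz e.
    by have := dual_neq0 dual hz; rewrite -e eqxx.
  + move=> a b; rewrite !mem_cat.
    case/orP => [ha|/mapP [y hy ->]]; case/orP => [hb|/mapP [z hz ->]].
    * exact: rF.
    * by rewrite mem_enum in hz; rewrite (negPf (Fb _ _ ha hz)).
    * by rewrite mem_enum in hy; rewrite (negPf (bF _ _ hb hy)).
    * by rewrite mem_enum in hy; rewrite mem_enum in hz; move/bb => ->.
- move=> i a; rewrite rowK mem_cat => /orP [ha|/mapP [z]].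
    by case: ifP => _; rewrite ?app_scalel; try apply: pdvd_mull; apply: tF.
  rewrite mem_enum => hz ->; have [->|iz] := eqVneq i z.
    by rewrite hz app_scalel; apply: pdvd_mulr; apply: pdvd_refl.
  by case: ifP => _; rewrite ?app_scalel; try apply: pdvd_mull; apply: hN.
exists c => //; pose g i := if i \in Z then lin (bt i) else 1.
have -> : scale_rows bt Z N = diag_mx (\row_i g i) *m N.
  apply/matrixP => i j; rewrite mul_diag_mx !mxE /g.
  by case: ifP; rewrite !mxE ?mul1r.
rewrite det_mulmx det_diag ed big_cat big_map big_enum /= -scalerAr mulrC.
congr (_ *: (_ * _)); rewrite [RHS]big_mkcond; apply: eq_bigr => i _.
by rewrite mxE.
Qed.

(** This records a basis for the restriction to the intersection of the hyperplanes [bt y = 0]. For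
    [F'] only an inclusion is recorded; tangency to all restricted forms is later derived from that
    of [T]. *)
Definition good F T bt us (Y : {set 'I_n}) :=
  [/\ forall y, y \in Y -> bt y \in F, dual_on bt us Y &
    exists2 F', saito F' (mrestr bt us (enum Y) T) &
      {subset F' <= [seq a *m mproj bt us (enum Y) | a <- F]}].

(** Rows in [Y] are replaced by constants and the others enter only through their restriction, so
    later blocks may alter the basis by elements vanishing on the intersection. *)
Lemma good_eq F T F2 T2 bt us Y : good F T bt us Y -> {subset F <= F2} ->
  (forall i, i \notin Y -> map_mx (lsub (mproj bt us (enum Y))) (row i T2)
                         = map_mx (lsub (mproj bt us (enum Y))) (row i T)) ->
  good F2 T2 bt us Y.
Proof.
move=> [h1 h2 [F' h3 h4]] sF eT; split=> // [y /h1 /sF //|].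
exists F'; last by move=> a /h4 /mapP [b /sF hb ->]; apply: map_f.
suff -> : mrestr bt us (enum Y) T2 = mrestr bt us (enum Y) T by [].
apply/row_matrixP => i; rewrite !row_mrestr mem_enum.
by case: (boolP (i \in Y)) => // /eT.
Qed.

(** [U] is restricted first and scaled afterwards: the forms [bt z] with [z] in [Z :\: Y] are fixed
    by the projection, so [saito_scale] applies to the restricted basis. *)
Lemma good_scale F U bt us Z Y v F2 : saito F U ->
  (forall a, a \in F -> dot a v != 0) -> (forall z, z \in Z -> dot (bt z) v = 0) ->
  dual_on bt us Z ->
  (forall z i, z \in Z -> i != z -> pdvd (lin (bt z)) (app (row i U) (bt z))) ->
  Y \subset Z -> {subset F ++ [seq bt z | z <- enum Z] <= F2} ->
  good F2 (scale_rows bt Z U) bt us Y.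
Proof.
move=> hs Fv bv dual hU YZ sF2; have sYZ := subsetP YZ.
have bF2 z : z \in Z -> bt z \in F2.
  by move=> hz; apply: sF2; rewrite mem_cat map_f ?orbT // mem_enum.
split; [by move=> y /sYZ /bF2 | exact: dual_sub dual |].
have [||||F1 s1 sub1] := saito_mrestr (v := v) (Y := enum Y) (al := bt) (u := us) hs (enum_uniq _).
- by move=> y z; rewrite !mem_enum => /sYZ hy /sYZ hz; apply: dual.
- by move=> y; rewrite mem_enum => /sYZ /bv.
- exact: Fv.
- by move=> y i; rewrite mem_enum => /sYZ; apply: hU.
set P := mproj bt us (enum Y) in sub1 *; set N := mrestr bt us (enum Y) U in s1.
have fixP z : z \in Z -> z \notin Y -> bt z *m P = bt z.
  move=> hz hzY; apply: mproj_id => y; rewrite mem_enum => hy.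
  rewrite (dual z y hz (sYZ _ hy)); have [e|//] := eqVneq z y.
  by rewrite e hy in hzY.
have sD z : z \in Z :\: Y -> z \in Z by rewrite inE => /andP [].
have F1v a : a \in F1 -> dot a v != 0.
  move=> /sub1 /mapP [b hb ->]; rewrite dot_mproj; first exact: Fv.
  by move=> y; rewrite mem_enum => /sYZ /bv.
exists (F1 ++ [seq bt z | z <- enum (Z :\: Y)]).
  have -> : mrestr bt us (enum Y) (scale_rows bt Z U) = scale_rows bt (Z :\: Y) N.
    apply/row_matrixP => i; rewrite [RHS]rowK !row_mrestr mem_enum in_setD.
    case: (boolP (i \in Y)) => iY; rewrite ?andFb ?andTb // rowK.
    case: (boolP (i \in Z)) => iZ //.
    apply/rowP => j; rewrite !mxE [LHS]rmorphM /= lsub_lin -/P fixP //.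
  apply: (@saito_scale F1 N bt us (Z :\: Y) v) => //.
  - by move=> z /sD /bv.
  - exact: dual_sub (subsetDl _ _) dual.
  move=> z i hz iz; have hzZ := sD z hz.
  have hzY : z \notin Y by move: hz; rewrite inE => /andP [].
  rewrite row_mrestr mem_enum; case: ifP => iY.
    by rewrite app_cst (dual z i hzZ (sYZ _ iY)) eq_sym (negPf iz) raddf0; apply: pdvd0.
  rewrite -lsub_app -{1}(fixP z) // -lsub_lin; apply: lsub_pdvd; exact: hU.
move=> a; rewrite mem_cat => /orP [/sub1 /mapP [b hb ->]|/mapP [z]].
  by apply: map_f; apply: sF2; rewrite mem_cat hb.
rewrite mem_enum inE => /andP [hzY hz] ->; apply/mapP; exists (bt z); first exact: bF2.
by rewrite fixP.
Qed.

(** Under the invariant these are the rows multiplied at the last block. The condition [0 < e i]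
    empties the set at [k = 0], where no row has been multiplied yet. *)
Definition top e k : {set 'I_n} := [set i | (e i == k) && (0 < e i)%N].

(* The fourth clause provides restrictions to intersections of hyperplanes of the
   last block, the fifth those of smaller dimension, found at earlier blocks; the
   rows outside [Y] form their bases. *)
Definition mat_inv F T e k := [/\ saito F T, forall i j, T i j \is (e i).-homog,
  forall i, (e i <= k)%N,
  exists bt us,
    (forall Y, Y \subset top e k -> good F T bt us Y) /\
    forall i, i \in top e k -> exists w, row i T = lin (bt i) *: w &
  forall j, (#|top e k| < j <= #|[set i | 0 < e i]|)%N ->
    exists Y bt us, [/\ #|Y| = j, top e k \subset Y, good F T bt us Y &
      forall y i, y \in Y -> i \notin Y -> (e i <= e y)%N]].

Lemma mat_inv0 : mat_inv [::] 1%:M (fun=> 0%N) 0.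
Proof.
have s0 : saito [::] (1%:M : 'M[S]_n).
  split=> //; exists 1; first exact: oner_neq0.
  by rewrite det1 big_nil scale1r.
have top0 : top (fun=> 0%N) 0 = set0 by apply/setP => i; rewrite !inE.
split=> // [i j||j].
- by rewrite mxE; case: eqP => _; [exact: dhomog1 | exact: dhomog0].
- exists (fun=> 0), (fun=> 0); split=> [Y|i]; rewrite top0 ?inE // subset0 => /eqP ->.
  split=> [y|y z|]; rewrite ?inE //; exists [::] => //.
  suff -> : mrestr (fun=> 0) (fun=> 0) (enum set0) (1%:M : 'M[S]_n) = 1%:M by [].
  apply/row_matrixP => i; rewrite row_mrestr enum_set0 /=.
  by apply/rowP => j; rewrite /mproj big_nil subr0 !mxE lsub1.
have -> : [set i : 'I_n | (0 < 0)%N] = set0 by apply/setP => i; rewrite !inE.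
by rewrite top0 cards0; case: j => // j /andP [].
Qed.

Lemma saito_perm F F' T : perm_eq F F' -> saito F T -> saito F' T.
Proof.
move=> pe [red tT [c c0 ed]]; split; first exact: reduced_perm red.
  by move=> i a; rewrite -(perm_mem pe); apply: tT.
by exists c; rewrite // -(perm_big _ pe).
Qed.

(** The pivots [Z] of the new block become the new top rows, and lie in the old top when [k] is
    positive. Subsets of [Z] are good by scaling; larger sets reuse an intersection from an earlier
    block, chosen to contain [Z] so that the change of basis does not affect its restriction. *)
Lemma mat_inv_step F T e k q (al u : 'I_q -> 'rV[K]_n) v : mat_inv F T e k ->
  (forall t s, dot (al t) (u s) = (t == s)%:R) -> (forall t, dot (al t) v = 0) ->
  (forall a, a \in F -> dot a v != 0) ->
  (forall t, restr_defect F (al t) (u t) k) ->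
  exists T' e', mat_inv (F ++ [seq al t | t <- enum 'I_q]) T' e' k.+1.
Proof.
move=> [hs hom ek [bt0 [us0 [goodT mulT]]] lowT] dual av Fv cnt.
have [f [U [G [injf fk [hsU homU] Uout tU]]]] := mat_adapt hs hom ek dual av Fv cnt.
pose inv i := [pick t | f t == i].
have invf t : inv (f t) = Some t.
  rewrite /inv; case: pickP => [s /eqP /injf -> //|/(_ t)]; by rewrite eqxx.
pose bt i := if inv i is Some t then al t else 0.
pose us i := if inv i is Some t then u t else 0.
have btf t : bt (f t) = al t by rewrite /bt invf.
have usf t : us (f t) = u t by rewrite /us invf.
pose Z := [set f t | t : 'I_q].
have ZP z : z \in Z -> exists t, z = f t by case/imsetP => t _ ->; exists t.
have fZ t : f t \in Z by apply: imset_f.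
have dualZ : dual_on bt us Z.
  by move=> y z /ZP [t ->] /ZP [s ->]; rewrite btf usf dual (inj_eq injf).
have bv z : z \in Z -> dot (bt z) v = 0 by move=> /ZP [t ->]; rewrite btf.
have tZ z i : z \in Z -> i != z -> pdvd (lin (bt z)) (app (row i U) (bt z)).
  by move=> /ZP [t ->]; rewrite btf; apply: tU.
have pe : perm_eq [seq bt z | z <- enum Z] [seq al t | t <- enum 'I_q].
  have pZ : perm_eq (enum Z) [seq f t | t <- enum 'I_q].
    apply: uniq_perm => [||z]; first exact: enum_uniq.
      by rewrite map_inj_uniq // enum_uniq.
    rewrite mem_enum; apply/idP/mapP => [/ZP [t ->]|[t _ ->]] //.
    by exists t; rewrite ?mem_enum.
  apply: perm_trans (perm_map bt pZ) _; rewrite -map_comp.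
  by rewrite (eq_map (fun t => btf t : (bt \o f) t = al t)).
pose F2 := F ++ [seq al t | t <- enum 'I_q].
pose T' := scale_rows bt Z U; pose e' i := if i \in Z then k.+1 else e i.
have peF : perm_eq (F ++ [seq bt z | z <- enum Z]) F2 by rewrite perm_cat2l.
have topE : top e' k.+1 = Z.
  apply/setP => i; rewrite !inE /e'; case: ifP => _; rewrite ?eqxx //.
  by apply/negbTE; rewrite negb_and neq_ltn ltnS ek.
have rT' i : i \notin Z -> row i T' = row i U by move=> /negPf h; rewrite rowK h.
have e'out i : i \notin Z -> e' i = e i by rewrite /e' => /negPf ->.
have Zcod i : (i \in codom f) = (i \in Z).
  apply/codomP/idP => [[t ->]|/ZP [t ->]] //; by exists t.
exists T', e'; split.
- exact: saito_perm peF (saito_scale hsU Fv bv dualZ tZ).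
- move=> i j; have -> : T' i j = row i T' 0 j by rewrite [RHS]mxE.
  rewrite rowK /e'; case: ifP => [/ZP [t ->]|_]; rewrite !mxE.
    by rewrite -add1n -(fk t); apply: dhomogM; [exact: lin_homog | exact: homU].
  exact: homU.
- by move=> i; rewrite /e'; case: ifP => // _; apply: leqW.
- exists bt, us; rewrite topE; split=> [Y YZ|i iZ]; last by rewrite rowK iZ; exists (row i U).
  apply: (good_scale hsU Fv bv dualZ tZ YZ) => a; by rewrite (perm_mem peF).
move=> j /andP []; rewrite topE => Zj jpos.
(* For [k = 0] all old degrees are zero, so only rows in [Z] acquire positive degree and no [j] is
   in range. *)
have k0 : (0 < k)%N.
  rewrite lt0n; apply: contraTneq Zj => k0; rewrite -leqNgt.
  apply: leq_trans jpos _; apply: subset_leq_card; apply/subsetP => i.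
  rewrite inE /e'; case: ifP => // _.
  by have := ek i; rewrite k0 leqn0 => /eqP ->.
have topZ : Z \subset top e k.
  by apply/subsetP => z /ZP [t ->]; rewrite inE fk eqxx.
have jpos' : (j <= #|[set i | 0 < e i]|)%N.
  apply: leq_trans jpos _; apply: subset_leq_card; apply/subsetP => i.
  by rewrite !inE /e'; case: ifP => // /(subsetP topZ); rewrite inE => /andP [].
have sF : {subset F <= F2} by move=> a ha; rewrite mem_cat ha.
have e'le Y : Z \subset Y -> (forall y i, y \in Y -> i \notin Y -> (e i <= e y)%N) ->
    forall y i, y \in Y -> i \notin Y -> (e' i <= e' y)%N.
  move=> ZY h y i yY iY; rewrite e'out; last by apply: contra iY; apply: (subsetP ZY).
  by rewrite /e'; case: ifP => _; [apply: leqW | apply: h].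
have [jt|jt] := leqP j #|top e k|; last first.
  have [|Y [bt1 [us1 [h1 h2 h3 h4]]]] := lowT j; first by rewrite jt.
  have ZY := subset_trans topZ h2.
  exists Y, bt1, us1; split=> //; last exact: e'le.
  apply: good_eq h3 sF _ => i iY.
  have iZ : i \notin Z by apply: contra iY; apply: (subsetP ZY).
  rewrite rT' //; have [|_ ->] // := Uout i; first by rewrite Zcod.
  (* A row of degree [k] lies in [top e k], hence in [Y]; a row outside [Y] has smaller degree and
     was left unchanged. *)
  apply: contra iY => ei; apply: (subsetP h2); rewrite inE ei (eqP ei) /=.
  by rewrite k0.
have [Y [ZY Yt cY]] := exists_subset_between topZ (introT andP (conj (ltnW Zj) jt)).
exists Y, bt0, us0; split=> //.
  apply: good_eq (goodT Y Yt) sF _ => i iY.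
  have iZ : i \notin Z by apply: contra iY; apply: (subsetP ZY).
  have [|eU _] := Uout i; first by rewrite Zcod.
  apply/rowP => l; rewrite rT' // eU mxE [RHS]mxE [X in lsub _ X]mxE rmorphD /=.
  rewrite [X in lsub _ X + _]mxE [X in _ + lsub _ X]mxE summxE rmorphN rmorph_sum /=.
  rewrite [row i T 0 l]mxE big1 ?subr0 // => s _.
  have fY : f s \in Y by apply: (subsetP ZY).
  (* The correction to row [i] combines rows [f s] with [f s] in [Y]. Each is a multiple of
     [lin (bt0 (f s))], which the substitution kills, so the correction restricts to zero. *)
  have [w ew] := mulT (f s) (subsetP Yt _ fY).
  have [_ dY _] := goodT Y Yt.
  have b0 : bt0 (f s) *m mproj bt0 us0 (enum Y) = 0.
    apply: mproj_kill; rewrite ?enum_uniq ?mem_enum // => z.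
    by rewrite mem_enum => zY; apply: dY.
  by rewrite ew !mxE !rmorphM /= lsub_lin b0 raddf0 mul0r mulr0.
apply: e'le => // y i /(subsetP Yt); rewrite inE => /andP [/eqP -> _] _; exact: ek.
Qed.

End Invariant.

(** * Derivations and forms on a vector space *)

Section Derivations.
Variables (K : fieldType).

Definition der n (th : 'rV[{mpoly K[n]}]_n) (p : {mpoly K[n]}) : {mpoly K[n]} :=
  \sum_j th 0 j * p^`M(j).

Lemma derX n (th : 'rV[{mpoly K[n]}]_n) j : der th 'X_j = th 0 j.
Proof.
rewrite /der (bigD1 j) //= mderivX mnm1E eqxx scale1r -{1}(addm0 U_(j)%MM).
rewrite addmC addmK mpolyX0 mulr1 big1 ?addr0 // => i /negPf ij.
by rewrite mderivX mnm1E eq_sym ij scale0r mulr0.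
Qed.

Lemma der_lin n (th : 'rV[{mpoly K[n]}]_n) a : der th (lin a) = app th a.
Proof.
rewrite /der /lin /app; under eq_bigr do rewrite raddf_sum mulr_sumr.
rewrite exchange_big /=; apply: eq_bigr => i _.
under eq_bigr do rewrite mderivZ -scalerAr.
by rewrite -scaler_sumr -/(der th 'X_i) derX.
Qed.

Lemma der_sum n (I : finType) (A : pred I) (h : I -> {mpoly K[n]})
    (th : I -> 'rV[{mpoly K[n]}]_n) p :
  der (\sum_(i | A i) h i *: th i) p = \sum_(i | A i) h i * der (th i) p.
Proof.
rewrite /der; under [RHS]eq_bigr do rewrite mulr_sumr.
rewrite exchange_big; apply: eq_bigr => j _.
by rewrite summxE mulr_suml; apply: eq_bigr => i _; rewrite mxE mulrA.
Qed.

Lemma app_mulmx n m l (th : 'rV[{mpoly K[l]}]_n) (M : 'M[K]_(m, n)) (b : 'rV[K]_m) :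
  app (th *m (cst l M)^T) b = app th (b *m M).
Proof.
rewrite /app; under eq_bigr do rewrite mxE scaler_sumr.
rewrite exchange_big; apply: eq_bigr => j _; rewrite mxE scaler_suml.
by apply: eq_bigr => i _; rewrite !mxE -mul_mpolyC mulrCA -[RHS]mul_mpolyC mpolyCM; ring.
Qed.

Variable W : vectType K.
Local Notation d := (\dim {:W}).
Implicit Types (t : symalg K W -> symalg K W).

Lemma der_derivation (th : 'rV[symalg K W]_d) : derivation (der th).
Proof.
split=> [c p q|p q]; rewrite /der.
  rewrite scaler_sumr -big_split; apply: eq_bigr => j _.
  by rewrite mderivD mderivZ mulrDr scalerAr.
rewrite mulr_suml mulr_sumr -big_split; apply: eq_bigr => j _ /=.
rewrite mderivM; ring.
Qed.

Lemma derivationE t : derivation t ->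
  forall p, t p = der (\row_j t 'X_j) p.
Proof.
move=> [tl tm]; have [dl dm] := der_derivation (\row_j t 'X_j).
have tD p q : t (p + q) = t p + t q by have := tl 1 p q; rewrite !scale1r.
have t1 : t 1 = 0.
  by have := tm 1 1; rewrite !mulr1 mul1r => e; apply: (addrI (t 1)); rewrite -e addr0.
have t0 : t 0 = 0 by apply: (addrI (t 0)); rewrite -tD !addr0.
elim/mpoly_rmorph_ind => [c|i|p q ep eq|p q ep eq].
- rewrite -[c%:MP]mulr1 mul_mpolyC -[c *: 1]addr0 tl t1 t0 scaler0 addr0.
  by rewrite addr0 alg_mpolyC /der big1 // => j _; rewrite mderivC mulr0.
- by rewrite derX mxE.
- by rewrite tD ep eq; have := dl 1 p q; rewrite !scale1r.
- by rewrite tm dm ep eq.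
Qed.

Definition crd (f : 'Hom(W, K^o)) : 'rV[K]_d := \row_i f (tnth (vbasis {:W}) i).
Definition cv (x : W) : 'rV[K]_d := \row_i coord (vbasis {:W}) i x.
Definition vc (w : 'rV[K]_d) : W := \sum_i w 0 i *: (vbasis {:W})`_i.

Lemma form_polyE f : form_poly f = lin (crd f).
Proof. by apply: eq_bigr => i _; rewrite mxE. Qed.

Lemma vcK : cancel vc cv.
Proof.
move=> w; apply/rowP => i; rewrite mxE coord_sum_free //.
exact: basis_free (vbasisP _).
Qed.

Lemma cvK : cancel cv vc.
Proof.
move=> x; rewrite [RHS](coord_vbasis (memvf x)).
by apply: eq_bigr => i _; rewrite mxE.
Qed.

Lemma vc_is_linear : linear vc.
Proof.
move=> c a b; rewrite /vc scaler_sumr -big_split; apply: eq_bigr => i _ /=.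
by rewrite !mxE scalerDl scalerA.
Qed.
HB.instance Definition _ := GRing.isLinear.Build K _ W _ vc vc_is_linear.

Lemma form_crd (f : 'Hom(W, K^o)) x : f x = dot (crd f) (cv x).
Proof.
rewrite -[in LHS](cvK x) /vc linear_sum dot_sum; apply: eq_bigr => i _.
by rewrite linearZ /= [crd f 0 i]mxE (tnth_nth 0) mulrC.
Qed.

Definition frm_fun (a : 'rV[K]_d) (x : W) : K^o := dot a (cv x).

Lemma frm_is_linear a : linear (frm_fun a).
Proof.
move=> c x y; rewrite /frm_fun !dot_sum scaler_sumr -big_split.
by apply: eq_bigr => i _ /=; rewrite !mxE linearP mulrDr scalerAr.
Qed.
HB.instance Definition _ a := GRing.isLinear.Build K W K^o _ _ (frm_is_linear a).

Definition frm (a : 'rV[K]_d) : 'Hom(W, K^o) := linfun (frm_fun a).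

Lemma frmE a x : frm a x = dot a (cv x).
Proof. by rewrite lfunE. Qed.

Lemma crd_frm a : crd (frm a) = a.
Proof.
apply/rowP => i; rewrite mxE frmE dot_sum (tnth_nth 0) (bigD1 i) //= mxE.
rewrite coord_free ?(basis_free (vbasisP _)) // eqxx mulr1 big1 ?addr0 // => j ji.
by rewrite mxE coord_free ?(basis_free (vbasisP _)) // eq_sym (negPf ji) mulr0.
Qed.

Lemma mem_lker_frm a x : (x \in lker (frm a)) = (dot a (cv x) == 0).
Proof. by rewrite memv_ker frmE. Qed.

(** The scalar is found by comparing both forms at a vector outside the common kernel; if there is
    none, both forms vanish. *)
Lemma lker_eq_crd (f g : 'Hom(W, K^o)) : lker f = lker g ->
  exists c, crd f = c *: crd g.
Proof.
move=> e; have [hg|] := boolP (fullv <= lker g)%VS.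
  exists 0; rewrite scale0r; apply/rowP => i; rewrite !mxE.
  have : tnth (vbasis {:W}) i \in lker f by rewrite e; apply/(subvP hg)/memvf.
  by rewrite memv_ker => /eqP.
case/subvPn => w _; rewrite memv_ker => gw.
exists (f w / g w); apply/rowP => i; rewrite !mxE; set x := tnth _ _.
have : x - (g x / g w) *: w \in lker f.
  by rewrite e memv_ker linearB linearZ /= [_ *: _]mulfVK // subrr.
rewrite memv_ker linearB linearZ /= subr_eq0 => /eqP ->.
by rewrite /GRing.scale /=; field.
Qed.

Definition forms_of (B : {fset {vspace W}}) (F : seq 'rV[K]_d) :=
  (forall H, H \in B -> exists2 a, a \in F & lker (frm a) = H) /\
  (forall a, a \in F -> a = 0 \/ lker (frm a) \in B).

Lemma tang0 n (th : 'rV[{mpoly K[n]}]_n) : pdvd (lin 0) (app th 0).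
Proof. by rewrite [app _ _]raddf0; apply: pdvd0. Qed.

Lemma logarithmicP B F t : forms_of B F -> derivation t ->
  logarithmic B t <-> tang F (\row_j t 'X_j).
Proof.
move=> [hB hF] dt; split=> [[_ h] a /hF [->|ha]|h]; first exact: tang0.
  have [q] := h _ (frm a) ha (erefl _).
  by rewrite form_polyE (derivationE dt) der_lin crd_frm; exists q.
split=> // H f /hB [a /h [q eq] e1] e2.
have [c ec] : exists c, crd f = c *: crd (frm a) by apply: lker_eq_crd; rewrite e2.
exists q; rewrite form_polyE (derivationE dt) der_lin ec crd_frm !linearZ /=.
by rewrite eq scalerAl.
Qed.

Lemma logarithmic_der B F th : forms_of B F -> tang F th -> logarithmic B (der th).
Proof.
move=> h1 h2; apply/(logarithmicP h1 (der_derivation th)).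
by have -> : \row_j der th 'X_j = th by apply/rowP => j; rewrite mxE derX.
Qed.

(* [J] pulls forms on the big space back to [W] and [R] extends them along the
   projection [P]; the rows in [Y] are the constant directions killed by [P]. *)
Lemma log_basis_restr n (J : 'M[K]_(n, d)) (R : 'M[K]_(d, n)) (P : 'M[K]_n)
    (N : 'M[{mpoly K[n]}]_n) (F F' : seq 'rV[K]_n) (B : {fset {vspace W}})
    (Y : pred 'I_n) (rows : seq 'I_n) :
  let Nbar i := map_mx (lsub J) (row i N) *m (cst d R)^T in
  R *m J = 1%:M -> J *m R = P ->
  forms_of B [seq a *m J | a <- F] ->
  saito F' N -> {subset F' <= [seq a *m P | a <- F]} ->
  (forall a i, a \in F -> pdvd (lin (a *m P)) (app (row i N) (a *m P))) ->
  (forall i, i \notin Y ->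
     row i N *m (cst n P)^T = row i N /\ map_mx (lsub P) (row i N) = row i N) ->
  (forall i, i \in Y -> row i N *m (cst n P)^T = 0) ->
  uniq rows -> (forall i, (i \in rows) = (i \notin Y)) ->
  log_basis B (fun r : 'I_(size rows) => der (nth 0 [seq Nbar i | i <- rows] r)).
Proof.
move=> Nbar RJ JR hB hN sF' tN NY NY0 uR mR.
have PJ : P *m J = J by rewrite -JR -mulmxA RJ mulmx1.
have nthN r : (r < size rows)%N -> exists2 i, i \in rows &
    nth 0 [seq Nbar i | i <- rows] r = Nbar i.
  case: rows uR mR => // i0 rows' uR mR hr; exists (nth i0 (i0 :: rows') r).
    exact: mem_nth.
  by rewrite (nth_map i0).
have sum_rows (h : 'I_(size rows) -> symalg K W) p :
    \sum_r h r * der (nth 0 [seq Nbar i | i <- rows] r) p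
    = der (\sum_r h r *: nth 0 [seq Nbar i | i <- rows] r) p by rewrite der_sum.
split=> [r|u lu].
  have [i _ ->] := nthN r (ltn_ord r); apply: (logarithmic_der hB).
  move=> _ /mapP [a ha ->]; rewrite app_mulmx -mulmxA JR -lsub_app.
  by rewrite -[in X in pdvd X _]PJ mulmxA -lsub_lin; apply: lsub_pdvd; apply: tN.
have du : derivation u by case: lu.
have tu : tang [seq a *m J | a <- F] (\row_j u 'X_j) by apply/(logarithmicP hB).
set ub := \row_j u 'X_j in tu.
(* The derivation [u] is extended to the big space along [P]; the extension is tangent to [F'],
   hence a combination of the rows of [N]. *)
have [|g eg] := saito_basis (th := map_mx (lsub R) ub *m (cst n J)^T) hN.
  move=> _ /sF' /mapP [a ha ->]; rewrite app_mulmx -mulmxA PJ -lsub_app.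
  by rewrite -JR mulmxA -lsub_lin; apply: lsub_pdvd; apply: tu; apply: map_f.
have RJt k : (cst k J)^T *m (cst k R)^T = 1%:M.
  by rewrite -trmx_mul -map_mxM RJ map_mx1 trmx1.
have JRt k : (cst k R)^T *m (cst k J)^T = (cst k P)^T.
  by rewrite -trmx_mul -map_mxM JR.
have Nbar0 i : i \in Y -> Nbar i = 0.
  move=> /NY0 h; rewrite /Nbar -(lsub_cst J R) map_trmx -map_mxM.
  have -> : row i N *m (cst n R)^T = 0.
    by rewrite -[LHS]mulmx1 -(RJt n) -mulmxA (mulmxA (cst n R)^T) JRt mulmxA h mul0mx.
  by rewrite map_mx0.
have ubE : ub = \sum_i lsub J (g 0 i) *: Nbar i.
  have : map_mx (lsub J) (map_mx (lsub R) ub *m (cst n J)^T) *m (cst d R)^T = ub.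
    rewrite map_mxM -map_trmx lsub_cst map_lsub_comp RJ -mulmxA RJt mulmx1.
    by apply/rowP => j; rewrite mxE lsub1.
  rewrite eg map_mxM => <-; rewrite [X in X *m _]mulmx_sum_row mulmx_suml.
  by apply: eq_bigr => i _; rewrite mxE -scalemxAl -map_row.
have reindex_rows m (h : 'I_n -> 'rV[{mpoly K[m]}]_d) :
    (forall i, i \in Y -> h i = 0) ->
    \sum_i h i = \sum_(r < size rows) nth 0 [seq h i | i <- rows] r.
  move=> h0; rewrite (bigID (mem rows)) /= [X in _ + X]big1 ?addr0 => [|i]; last first.
    by rewrite mR negbK; apply: h0.
  have -> : \sum_(i in rows) h i = \sum_(i <- rows) h i by rewrite big_uniq.
  rewrite -(big_map h xpredT id) (big_nth 0) size_map big_mkord.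
  by [].
have uq (h : 'I_(size rows) -> symalg K W) :
    \sum_r h r *: nth 0 [seq Nbar i | i <- rows] r = 0 -> forall r, h r = 0.
  move=> e0; case: (posnP (size rows)) => [s0 r|rows0].
    by have := leq_ltn_trans (leq0n r) (ltn_ord r); rewrite s0.
  have i0 : 'I_n by case: rows rows0 {uR mR nthN sum_rows e0 reindex_rows h} => [|i].
  have NbarE r : nth 0 [seq Nbar i | i <- rows] (r : 'I_(size rows)) = Nbar (nth i0 rows r).
    by rewrite (nth_map i0).
  (* A relation is lifted to one among the rows of [N], with coefficient zero at indices outside
     [rows], so that [saito_free] applies. *)
  pose G := \row_i \sum_(r | nth i0 rows (r : 'I_(size rows)) == i) lsub R (h r).
  have lift i : i \notin Y -> map_mx (lsub R) (Nbar i) *m (cst n J)^T = row i N.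
    move=> /NY [h1 h2]; rewrite /Nbar map_mxM map_lsub_comp JR h2 -map_trmx lsub_cst.
    by rewrite -mulmxA JRt h1.
  have G0 : G = 0.
    apply: (saito_free hN).
    have := congr1 (fun w => map_mx (lsub R) w *m (cst n J)^T) e0.
    rewrite map_mx0 mul0mx => <-; rewrite mulmx_sum_row.
    have -> : map_mx (lsub R) (\sum_r h r *: nth 0 [seq Nbar i | i <- rows] r) *m (cst n J)^T
       = \sum_r lsub R (h r) *: row (nth i0 rows (r : 'I_(size rows))) N.
      have -> : map_mx (lsub R) (\sum_r h r *: nth 0 [seq Nbar i | i <- rows] r) =
          \sum_r lsub R (h r) *: map_mx (lsub R) (nth 0 [seq Nbar i | i <- rows] r).
        apply/rowP => j; rewrite mxE !summxE rmorph_sum; apply: eq_bigr => r _ /=.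
        by rewrite [RHS]mxE [in LHS]mxE rmorphM [X in _ = _ * X]mxE.
      rewrite mulmx_suml; apply: eq_bigr => r _.
      rewrite -scalemxAl NbarE lift //; by rewrite -mR mem_nth.
    rewrite (partition_big (fun r : 'I_(size rows) => nth i0 rows r) xpredT) //=.
    apply: eq_bigr => i _; rewrite mxE scaler_suml; apply: eq_bigr => r /eqP -> //.
  move=> r; have : lsub R (h r) = 0.
    move/rowP/(_ (nth i0 rows r)): G0; rewrite !mxE (bigD1 r) //= big1 ?addr0 //.
    move=> r' /andP [/eqP e1 /eqP []]; apply/val_inj/eqP.
    by rewrite -(nth_uniq i0 _ _ uR) ?ltn_ord //; apply/eqP; exact: e1.
  move/(congr1 (lsub J)); rewrite lsub_comp RJ lsub1 => ->; exact: raddf0.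
pose gf := [ffun r : 'I_(size rows) => nth 0 [seq lsub J (g 0 i) | i <- rows] r].
have ubS : ub = \sum_(r < size rows) gf r *: nth 0 [seq Nbar i | i <- rows] r.
  rewrite ubE reindex_rows => [|i iY]; last by rewrite Nbar0 // scaler0.
  apply: eq_bigr => r _; rewrite ffunE.
  elim: (rows) (r : nat) => [|i s IH] [|k] //=; exact/esym/scaler0.
exists gf; split=> [p|g' hg'].
  by rewrite (derivationE du) -/ub ubS der_sum.
apply/ffunP => r; apply/eqP; rewrite -subr_eq0; apply/eqP.
apply: (uq (fun r => gf r - g' r)); under eq_bigr do rewrite scalerBl.
rewrite sumrB -ubS; apply/eqP; rewrite subr_eq0; apply/eqP/rowP => j.
rewrite mxE hg' summxE; apply: eq_bigr => r' _.
by rewrite derX [RHS]mxE.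
Qed.

End Derivations.

(** * Subspaces and restricted arrangements in coordinates *)

Section Subspaces.
Variables (K : fieldType) (V : vectType K).
Local Notation n := (\dim {:V}).
Implicit Types (H X : {vspace V}) (a b u w : 'rV[K]_n) (A : {fset {vspace V}}).

Lemma crdK (f : 'Hom(V, K^o)) : frm (crd f) = f.
Proof. by apply/lfunP => x; rewrite frmE form_crd. Qed.

(** For a hyperplane [H] the complement [H^C] is a line: this is the projection onto it along [H],
    followed by the coordinate in its generator. *)
Definition hyper_fun H (x : V) : K^o :=
  coord [tuple vpick (H^C)%VS] ord0 (daddv_pi (H^C)%VS H x).

Lemma hyper_fun_linear H : linear (hyper_fun H).
Proof. by move=> c x y; rewrite /hyper_fun !linearP. Qed.
HB.instance Definition _ H := GRing.isLinear.Build K V K^o _ _ (hyper_fun_linear H).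

Definition hf H : 'rV[K]_n := crd (linfun (hyper_fun H)).

Lemma lker_hf H : (\dim H).+1 = n -> lker (frm (hf H)) = H.
Proof.
move=> dH; rewrite /hf crdK.
have dHC : \dim (H^C) = 1%N by rewrite dimv_compl -dH subSnn.
have cap0 : (H^C :&: H)%VS = 0%VS by rewrite capvC capv_compl.
have cap0' : (H :&: H^C)%VS = 0%VS by rewrite capv_compl.
have addf x : x \in (H^C + H)%VS by rewrite addvC addv_complf memvf.
have HC0 : vpick (H^C)%VS != 0 by rewrite vpick0 -dimv_eq0 dHC.
have HCE : (H^C)%VS = <[vpick (H^C)]>%VS.
  apply/eqP; rewrite eq_sym eqEdim -memvE memv_pick /= dHC dim_vline HC0.
  by [].
apply/vspaceP => x; rewrite memv_ker lfunE /= /hyper_fun.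
have dec := daddv_pi_add cap0 (addf x).
apply/eqP/idP => [c0|xH].
  have p0 : daddv_pi (H^C) H x = 0.
    have : daddv_pi (H^C) H x \in <<[tuple vpick (H^C)%VS]>>%VS.
      by rewrite span_seq1 -HCE memv_pi.
    by move/coord_span => ->; rewrite big_ord1 c0 scale0r.
  by rewrite -dec p0 add0r memv_pi.
have : daddv_pi (H^C) H x = 0.
  apply: (addIr (daddv_pi H (H^C) x)).
  by rewrite dec add0r daddv_pi_id.
by move=> ->; rewrite linear0.
Qed.

Lemma hf_inj H H' : (\dim H).+1 = n -> (\dim H').+1 = n -> hf H = hf H' -> H = H'.
Proof. by move=> h h' e; rewrite -(lker_hf h) e lker_hf. Qed.

Lemma mem_hf H x : (\dim H).+1 = n -> (x \in H) = (dot (hf H) (cv x) == 0).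
Proof. by move=> h; rewrite -{1}(lker_hf h) mem_lker_frm. Qed.

(** Column [s] holds the ambient coordinates of the [s]-th basis vector of [X], so right
    multiplication restricts a coefficient row to [X]. *)
Definition pull X : 'M[K]_(n, \dim {:subvs_of X}) :=
  \matrix_(i, s) coord (vbasis {:V}) i (vsval (vbasis {:subvs_of X})`_s).

Lemma cv_vsval X (x : subvs_of X) : cv (vsval x) = cv x *m (pull X)^T.
Proof.
rewrite -{1}(cvK x); apply/rowP => i; rewrite !mxE !linear_sum.
by apply: eq_bigr => s _; rewrite !linearZ /= !mxE.
Qed.

Lemma lker_pull X b :
  lker (frm (b *m pull X)) = (linfun (vsval : subvs_of X -> V) @^-1: lker (frm b))%VS.
Proof.
apply/vspaceP => x; rewrite -memv_preim lfunE /= !mem_lker_frm.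
by rewrite dot_mulr -cv_vsval.
Qed.

Lemma pull_eq0 X b : b *m pull X = 0 <-> (forall x, x \in X -> dot b (cv x) = 0).
Proof.
split=> [h x xX|h].
  by rewrite -(vsprojK xX) cv_vsval -dot_mulr h /dot mul0mx mxE.
apply/rowP => s; rewrite [RHS]mxE.
have := h _ (subvsP (vbasis {:subvs_of X})`_s); rewrite dot_sum => <-.
by rewrite mxE; apply: eq_bigr => i _; rewrite !mxE.
Qed.

(** Forms on [X] are first extended through [L] and then composed with the projection [P^T] onto
    [X]. The result depends only on the restriction to [X], because [P] kills every form vanishing
    there. *)
Lemma pull_retract X (P : 'M[K]_n) :
  (forall x, x \in X -> cv x *m P^T = cv x) ->
  (forall w, vc (w *m P^T) \in X) ->
  exists R, [/\ R *m pull X = 1%:M, pull X *m R = P, P *m pull X = pull X &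
    forall b, b *m pull X = 0 -> b *m P = 0].
Proof.
move=> hX hP; set J := pull X.
have kill b : b *m J = 0 -> b *m P = 0.
  move=> /pull_eq0 h; apply/rowP => i; rewrite [RHS]mxE.
  have := h _ (hP (delta_mx 0 i)); rewrite vcK -dot_mulr => <-.
  by rewrite /dot trmx_delta -colE [RHS]mxE.
have PJ : P *m J = J.
  have h (b : 'rV[K]_n) : (b *m P - b) *m J = 0.
    apply/pull_eq0 => x xX; rewrite /dot mulmxBl mxE [X in _ + X]mxE.
    by rewrite -/(dot (b *m P) (cv x)) dot_mulr hX // subrr.
  apply/row_matrixP => i; rewrite row_mul !rowE; apply/eqP.
  by rewrite -subr_eq0 -mulmxBl h.
pose L : 'M[K]_(\dim {:subvs_of X}, n) :=
  \matrix_(s, i) coord (vbasis {:subvs_of X}) s (vsproj X (vbasis {:V})`_i).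
have LJ : L *m J = 1%:M.
  apply/matrixP => s t; rewrite mxE.
  transitivity (coord (vbasis {:subvs_of X}) s (vsproj X (vsval (vbasis {:subvs_of X})`_t))).
    rewrite [in RHS](coord_vbasis (memvf (vsval _))) !linear_sum /=.
    by apply: eq_bigr => i _; rewrite !linearZ /= !mxE mulrC.
  by rewrite vsvalK coord_free ?(basis_free (vbasisP _)) // mxE eq_sym.
exists (L *m P); split=> //; first by rewrite -mulmxA PJ.
apply/row_matrixP => i; rewrite !rowE; apply/eqP.
rewrite -subr_eq0 !mulmxA -mulmxBl; apply/eqP/kill.
by rewrite mulmxBl -!mulmxA LJ mulmx1 subrr.
Qed.

Lemma mem_bigcapv (I : eqType) (s : seq I) (G : I -> {vspace V}) x :
  (x \in (\bigcap_(i <- s) G i)%VS) = all (fun i => x \in G i) s.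
Proof.
by elim: s => [|i s IH]; rewrite ?big_nil ?memvf // big_cons memv_cap IH.
Qed.

Lemma dim_form_image (f : 'Hom(V, K^o)) X : (\dim (f @: X) <= 1)%N.
Proof. by apply: leq_trans (dimvS (subvf _)) _; rewrite dimvf. Qed.

Lemma dim_bigcap_ge (s : seq 'rV[K]_n) :
  (n <= \dim (\bigcap_(a <- s) lker (frm a))%VS + size s)%N.
Proof.
elim: s => [|a s IH]; first by rewrite big_nil addn0.
rewrite big_cons capvC /=; set U' := (\bigcap_(_ <- _) _)%VS.
apply: leq_trans IH _; rewrite -(limg_ker_dim (frm a) U') -addnA leq_add2l.
by rewrite -(add1n (size s)) leq_add2r dim_form_image.
Qed.

(** The vector of [us y] lies in the kernels of the other forms but not in that of [bt y], so every
    form lowers the dimension by exactly one. *)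
Lemma dim_bigcap_dual (I : eqType) (bt us : I -> 'rV[K]_n) (s : seq I) : uniq s ->
  {in s &, forall y z, dot (bt y) (us z) = (y == z)%:R} ->
  (\dim (\bigcap_(y <- s) lker (frm (bt y)))%VS + size s)%N = n.
Proof.
elim: s => [|y s IH] /= => [_ _|/andP [ys us'] d]; first by rewrite big_nil addn0.
rewrite big_cons capvC; set U := (\bigcap_(_ <- _) _)%VS.
have <- : (\dim U + size s)%N = n.
  by apply: IH => // i j hi hj; apply: d; rewrite inE ?hi ?hj orbT.
rewrite -(limg_ker_dim (frm (bt y)) U) -addnA -(add1n (size s)).
congr (_ + (_ + _))%N.
apply/esym/eqP; rewrite eqn_leq dim_form_image lt0n dimv_eq0.
apply/eqP => e0; have : frm (bt y) (vc (us y)) \in (frm (bt y) @: U)%VS.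
  apply: memv_img; rewrite mem_bigcapv; apply/allP => z zs.
  rewrite mem_lker_frm vcK d ?mem_head //; last by rewrite inE zs orbT.
  have [e|_] := eqVneq y z; last by rewrite eqxx.
  by rewrite e zs in ys.
by rewrite e0 memv0 frmE vcK d ?mem_head // eqxx oner_eq0.
Qed.

Lemma forms_restriction A X : arrangement A ->
  forms_of (restriction A X) [seq a *m pull X | a <- [seq hf H | H <- A]].
Proof.
move=> hA; split=> [H' /imfsetP [H /= ]|a /mapP [b /mapP [H HA ->] ->]].
  rewrite !inE => /andP [_ HA] ->; exists (hf H *m pull X).
    by do 2!apply: map_f.
  by rewrite lker_pull lker_hf // hA.
have [XH|XH] := boolP (X <= H)%VS.
  left; apply/pull_eq0 => x /(subvP XH); rewrite mem_hf ?hA // => /eqP.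
  by [].
right; apply/imfsetP; exists H => /=; last by rewrite lker_pull lker_hf // hA.
by rewrite !inE HA (negPf XH).
Qed.

(** The representatives [R] correspond to the hyperplanes of the restriction, so the number of
    discarded forms [B] is the quantity in the third MAT condition. *)
Lemma restr_defect_card A H u (F : seq 'rV[K]_n) : arrangement A ->
  (\dim H).+1 = n -> H \notin A -> dot (hf H) u = 1 ->
  perm_eq F [seq hf L | L <- A] ->
  restr_defect F (hf H) u (#|` A| - #|` restriction (H |` A) H|)%N.
Proof.
move=> hA hH HA du pF R B pe inj red cls; set P := proj u (hf H) in inj red cls.
have PT w : w *m P^T = w - dot (hf H) w *: u.
  rewrite /P /proj linearB /= trmx1 trmx_mul trmxK mulmxBr mulmx1 mulmxA dotE.
  by rewrite mul_scalar_mx dot_sym.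
have [||Rm [RJ JR PJ kill]] := @pull_retract H P.
- by move=> x xH; rewrite PT; move: xH; rewrite mem_hf // => /eqP ->; rewrite scale0r subr0.
- by move=> w; rewrite mem_hf // vcK -dot_mulr proj_id // /dot mul0mx mxE.
have FA a : (a \in F) = (a \in [seq hf L | L <- A]) by apply: perm_mem.
have sR r : r \in R -> r \in F by rewrite (perm_mem pe) mem_cat => ->.
have uF : uniq F.
  rewrite (perm_uniq pF) map_inj_in_uniq ?fset_uniq // => K1 K2 h1 h2.
  by apply: hf_inj; apply: hA.
have uR : uniq R by move: uF; rewrite (perm_uniq pe) cat_uniq => /and3P [].
pose pre L : {vspace subvs_of H} := (linfun (vsval : subvs_of H -> V) @^-1: L)%VS.
have preE L : L \in A -> pre L = lker (frm (hf L *m pull H)).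
  by move=> KA; rewrite lker_pull lker_hf // hA.
have memres (H' : {vspace subvs_of H}) : reflect (exists2 L, L \in A & H' = pre L) (H' \in restriction (H |` A) H).
  apply: (iffP idP) => [/imfsetP [L /=]|[L KA ->]].
    rewrite !inE => /andP [h1 /orP [/eqP e|KA]] ->; last by exists L.
    by rewrite e eqxx subvv in h1.
  apply/imfsetP; exists L => //=; rewrite !inE KA orbT andbT /=; apply: contra HA => HK.
  suff -> : H = L by [].
  by apply/eqP; rewrite eqEdim HK -ltnS hH hA ?leqnn.
have perm : perm_eq (restriction (H |` A) H) [seq lker (frm (r *m pull H)) | r <- R].
  apply: uniq_perm; first exact: fset_uniq.
    rewrite map_inj_in_uniq // => r r' hr hr' /lker_eq_crd [c].
    rewrite !crd_frm => e; apply: inj => //.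
    case: red => _ _ h; apply: h; [exact: (map_f (mulmx^~ P)) | exact: (map_f (mulmx^~ P)) |].
    apply/sub_rVP; exists c; apply/eqP; rewrite -subr_eq0 scalemxAl -mulmxBl.
    by apply/eqP; apply: kill; rewrite mulmxBl e scalemxAl subrr.
  move=> H'; apply/memres/mapP => [[L KA ->]|[r hr ->]]; last first.
    have : r \in F by apply: sR.
    by rewrite FA => /mapP [L KA e]; exists L; rewrite // preE // e.
  have [r hr /sub_rVP [c e]] : exists2 r, r \in R & (hf L *m P <= r *m P)%MS.
    have : hf L \in F by rewrite FA map_f.
    rewrite (perm_mem pe) mem_cat => /orP [h|/cls //]; by exists (hf L).
  exists r => //; rewrite preE //.
  have e2 : hf L *m pull H = c *: (r *m pull H).
    by rewrite -PJ !mulmxA e -scalemxAl.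
  have c0 : c != 0.
    apply: contraNneq HA => c0; suff -> : H = L by [].
    apply/eqP; rewrite eqEdim -ltnS hH hA // leqnn andbT; apply/subvP => x xH.
    have /pull_eq0 h : hf L *m pull H = 0 by rewrite e2 c0 scale0r.
    by rewrite mem_hf ?hA // h.
  apply/vspaceP => x; rewrite !mem_lker_frm e2 dotZl mulf_eq0 (negPf c0) //.
have -> : #|` A| = size F by rewrite (perm_size pF) size_map.
rewrite (perm_size perm) size_map (perm_size pe) size_cat addKn //.
Qed.

End Subspaces.

(** * MAT-free arrangements *)

Lemma take_sort_split (I : eqType) (e : I -> nat) (s1 s2 s : seq I) :
  perm_eq s (s1 ++ s2) -> {in s1 & s2, forall i j, (e i <= e j)%N} ->
  take (size s1) (sort leq [seq e i | i <- s]) = sort leq [seq e i | i <- s1].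
Proof.
move=> ps h.
have -> : sort leq [seq e i | i <- s] =
    sort leq [seq e i | i <- s1] ++ sort leq [seq e i | i <- s2].
  apply: (sorted_eq leq_trans anti_leq); first exact: sort_sorted leq_total _.
    rewrite (sorted_pairwise leq_trans) pairwise_cat.
    rewrite -!(sorted_pairwise leq_trans) !sort_sorted ?andbT //; try exact: leq_total.
    by apply/allrelP => x y; rewrite !mem_sort => /mapP [i hi ->] /mapP [j hj ->]; apply: h.
  rewrite perm_sort (perm_trans (perm_map e ps)) // map_cat.
  by apply: perm_cat; rewrite perm_sym perm_sort.
by rewrite take_size_cat // size_sort size_map.
Qed.

Section Main.
Variables (K : fieldType) (V : vectType K).
Local Notation n := (\dim {:V}).
Local Notation S := (symalg K V).
Implicit Types (A P : {fset {vspace V}}) (X H : {vspace V}) (F : seq 'rV[K]_n).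
Implicit Types (T : 'M[S]_n) (e : 'I_n -> nat) (Y : {set 'I_n}).

Lemma mem_center A x : (x \in center A) = all (fun H => x \in H) A.
Proof. exact: mem_bigcapv. Qed.

(** A relation with [c t] nonzero would let hyperplane [t] be omitted from the intersection, which
    would then be larger than the rank permits. So the forms are independent, and the columns of a
    right inverse of their matrix are the dual vectors. *)
Lemma block_dual P : arrangement P -> rk P = #|` P| ->
  exists u : 'I_(size P) -> 'rV[K]_n, forall t s,
    dot (hf (tnth (in_tuple P) t)) (u s) = (t == s)%:R.
Proof.
move=> hP rP; set al := fun t => hf (tnth (in_tuple P) t).
have hal t : (\dim (tnth (in_tuple P) t)).+1 = n by apply: hP; apply: mem_tnth.
pose M : 'M[K]_(size P, n) := \matrix_t al t.
have dimP : (\dim (center P) + size P)%N = n.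
  have := rP; rewrite /rk => <-; apply: subnKC; exact: dimvS (subvf _).
have fM : row_free M.
  apply: inj_row_free => c cM; apply/eqP; apply/negPn/negP => /rV0Pn [t ct].
  pose s := [seq al i | i <- rem t (enum 'I_(size P))].
  have ss : (size s).+1 = size P.
    rewrite size_map size_rem ?mem_enum // size_enum_ord prednK //.
    exact: leq_ltn_trans (leq0n t) (ltn_ord t).
  have sub : (\bigcap_(a <- s) lker (frm a) <= center P)%VS.
    apply/subvP => x; rewrite mem_bigcapv mem_center => /allP hx.
    have h i : i != t -> dot (al i) (cv x) = 0.
      move=> it; apply/eqP; rewrite -mem_lker_frm; apply: hx; apply: map_f.
      by rewrite mem_rem_uniq ?enum_uniq // inE it mem_enum.
    have ht : dot (al t) (cv x) = 0.
      have : dot (c *m M) (cv x) = 0 by rewrite cM /dot mul0mx mxE.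
      rewrite mulmx_sum_row /dot mulmx_suml summxE (bigD1 t) //= big1 => [|i it].
        by rewrite addr0 rowK -/(dot _ _) dotZl => /eqP; rewrite mulf_eq0 (negPf ct) => /eqP.
      by rewrite rowK -/(dot _ _) dotZl h // mulr0.
    apply/allP => H HP; have [i ->] : exists i, H = tnth (in_tuple P) i by apply/tnthP.
    rewrite mem_hf // -/(al i); apply/eqP; have [->//|] := eqVneq i t; exact: h.
  have := leq_trans (dim_bigcap_ge s) (leq_add (dimvS sub) (leqnn _)).
  by rewrite leqNgt -addnS ss dimP leqnn.
have [U MU] := row_freeP fM.
exists (fun s => (col s U)^T) => t s.
have := congr1 (fun A : 'M[K]_(size P) => A t s) MU; rewrite !mxE => <-.
by rewrite dot_sum; apply: eq_bigr => j _; rewrite !mxE.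
Qed.

Lemma mat_inv_block A P F T e k : arrangement (A `|` P) ->
  perm_eq F [seq hf H | H <- A] -> mat_inv F T e k -> rk P = #|` P| ->
  ~ (forall v, v \in center P -> exists2 H', H' \in A & v \in H') ->
  (forall H, H \in P -> (#|` A| - #|` restriction (H |` A) H|)%N = k) ->
  exists F' T' e', perm_eq F' [seq hf H | H <- A `|` P] /\ mat_inv F' T' e' k.+1.
Proof.
move=> hAP pF inv rP nc cnt.
have hA : arrangement A by move=> H HA; apply: hAP; rewrite inE HA.
have hP : arrangement P by move=> H HP; apply: hAP; rewrite inE HP orbT.
(* The second MAT condition negates a universal statement; classical logic extracts a point of the
   new hyperplanes outside [A], which also shows that [P] and [A] are disjoint. *)
have [v vP vA] : exists2 v, v \in center P & forall H, H \in A -> v \notin H.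
  apply: NNPP => h; apply: nc => v vP; apply: NNPP => h2; apply: h; exists v => // H HA.
  by apply/negP => vH; apply: h2; exists H.
have [u dual] := block_dual hP rP.
have vPt t : v \in tnth (in_tuple P) t.
  by move: vP; rewrite mem_center => /allP; apply; apply: mem_tnth.
have PA t : tnth (in_tuple P) t \notin A by apply/negP => /vA; rewrite vPt.
have ht t : tnth (in_tuple P) t \in P by apply: mem_tnth.
have [|||T' [e' inv']] := mat_inv_step (v := cv v) inv dual.
- by move=> t; apply/eqP; rewrite -mem_hf // hP.
- move=> a; rewrite (perm_mem pF) => /mapP [H HA ->].
  by rewrite -mem_hf ?hA // vA.
- move=> t; rewrite -(cnt _ (ht t)); apply: restr_defect_card => //; first exact: hP.
  by rewrite dual eqxx.
exists (F ++ [seq hf (tnth (in_tuple P) t) | t <- enum 'I_(size P)]), T', e'; split=> //.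
apply: (@perm_trans _ [seq hf H | H <- enum_fset A ++ enum_fset P]).
  rewrite map_cat perm_cat // map_comp.
  by rewrite map_tnth_enum.
apply: perm_map; apply: uniq_perm; last by move=> H; rewrite mem_cat inE.
  rewrite cat_uniq !fset_uniq andbT; apply/hasPn => H HP; apply/negP => /vA.
  by move: vP; rewrite mem_center => /allP /(_ H HP) ->.
exact: fset_uniq.
Qed.

Lemma mat_inv_free A : arrangement A -> MAT_free A ->
  exists F T e k, perm_eq F [seq hf H | H <- A] /\ mat_inv F T e k.
Proof.
move=> hA [pi [_ _ eA] hpi].
suff h k : (k <= size pi)%N -> exists F T e,
    perm_eq F [seq hf H | H <- \bigcup_(B <- take k pi) B] /\ mat_inv F T e k.
  have [F [T [e]]] := h _ (leqnn _); rewrite take_size -eA => h'.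
  by exists F, T, e, (size pi).
have sub j : \bigcup_(B <- take j pi) B `<=` A.
  apply/fsubsetP => H; rewrite eA => /bigfcupP [B]; rewrite andbT => hB HB.
  by apply/bigfcupP; exists B; rewrite // andbT (mem_take hB).
elim: k => [_|k IH kpi].
  exists [::], 1%:M, (fun=> 0%N); rewrite take0 big_nil; split=> //.
  exact: mat_inv0.
have [F [T [e [pF inv]]]] := IH (ltnW kpi).
have [h1 h2 h3] := hpi k kpi.
have eB : \bigcup_(B <- take k.+1 pi) B = \bigcup_(B <- take k pi) B `|` nth fset0 pi k.
  by rewrite (take_nth fset0) // -cats1 big_cat big_seq1.
rewrite eB; apply: (mat_inv_block _ pF inv h1 h2 h3).
by move=> H; rewrite -eB => /(fsubsetP (sub _)); apply: hA.
Qed.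

Lemma homog0_const (p : S) : p \is 0.-homog -> p = (p@_0%MM)%:MP.
Proof.
move=> hp; apply: msize1_polyC; have [->|p0] := eqVneq p 0; first by rewrite msize0.
by rewrite (dhomog_size p0 hp).
Qed.

(** A basis element of degree zero is a constant vector; its value on a defining form is a constant
    divisible by that form, hence zero, so the vector lies in the center. Hence for [d] at least the
    dimension of the center there are at least [n - d] rows of positive degree. *)
Lemma degree0_center A F T e : arrangement A -> perm_eq F [seq hf H | H <- A] ->
  saito F T -> (forall i j, T i j \is (e i).-homog) ->
  (#|[set i | e i == 0%N]| <= \dim (center A))%N.
Proof.
move=> hA pF sT hom; set E := [set i | _].
pose w (i : 'I_n) : 'rV[K]_n := \row_j (T i j)@_0%MM.
have Tw i : i \in E -> row i T = cst n (w i).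
  rewrite inE => /eqP ei; apply/rowP => j; rewrite !mxE.
  by apply: homog0_const; have := hom i j; rewrite ei.
pose X := [tuple vc (w (enum_val (r : 'I_(#|E|)))) | r < #|E|].
have freeX : free X.
  apply/freeP => c ce r; pose G : 'rV[S]_n := \row_i \sum_(r | enum_val (r : 'I_(#|E|)) == i) (c r)%:MP.
  have G0 : G = 0.
    apply: (saito_free sT).
    have e0 : \sum_r c r *: w (enum_val (r : 'I_(#|E|))) = 0.
      apply: (can_inj (@vcK K V)); rewrite raddf0 raddf_sum -[RHS]ce.
      by apply: eq_bigr => i _; rewrite /= linearZ /= nth_mktuple.
    rewrite -[RHS](map_mx0 (@mpolyC n K)) -e0 mulmx_sum_row.
    have -> : map_mx (@mpolyC n K) (\sum_r c r *: w (enum_val (r : 'I_(#|E|))))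
        = \sum_r (c r)%:MP *: row (enum_val (r : 'I_(#|E|))) T.
      apply/rowP => j; rewrite mxE !summxE raddf_sum; apply: eq_bigr => i _ /=.
      by rewrite (Tw _ (enum_valP i)) !mxE mpolyCM.
    rewrite [RHS](partition_big (fun r : 'I_(#|E|) => enum_val r) xpredT) //=.
    apply: eq_bigr => i _; rewrite mxE scaler_suml.
    by apply: eq_bigr => r' /eqP ->.
  move/rowP/(_ (enum_val r)): G0; rewrite !mxE (bigD1 r) //= big1 ?addr0.
    by move/eqP; rewrite mpolyC_eq0 => /eqP.
  by move=> r' /andP [/eqP /enum_val_inj ->]; rewrite eqxx.
have -> : #|E| = \dim <<X>> by move: freeX; rewrite /free size_tuple => /eqP.
apply: dimvS; apply/span_subvP => x /mapP [r _ ->]; rewrite mem_center.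
apply/allP => H HA; rewrite mem_hf ?hA // vcK; apply/eqP.
have hF : hf H \in F by rewrite (perm_mem pF) map_f.
case: sT => -[_ z _] /(_ (enum_val r) _ hF); rewrite (Tw _ (enum_valP r)) app_cst.
have h0 : hf H != 0 by apply: contraNneq z => <-.
have [u du] := exists_dual h0.
move=> /(lsub_proj_eq0 _ du); rewrite lsubC => /eqP; rewrite mpolyC_eq0 => /eqP -> //.
Qed.

Lemma app_ext m l (th th' : 'rV[{mpoly K[l]}]_m) :
  (forall b : 'rV[K]_m, app th b = app th' b) -> th = th'.
Proof.
move=> h; apply/rowP => j; have := h (delta_mx 0 j).
have E (t : 'rV[{mpoly K[l]}]_m) : app t (delta_mx 0 j) = t 0 j.
  rewrite /app (bigD1 j) //= mxE !eqxx scale1r big1 ?addr0 // => i /negPf ij.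
  by rewrite mxE ij andbF scale0r.
by rewrite !E.
Qed.

(** [k] is kept apart from [size e] so that bases indexed by a list of rows can be used without
    casts between ordinal types. *)
Lemma log_basis_free (W : vectType K) (B : {fset {vspace W}}) (e : seq nat) k
    (N : seq 'rV[symalg K W]_(\dim {:W})) : k = size e ->
  log_basis B (fun r : 'I_k => der (nth 0 N r)) ->
  (forall r j, (r < k)%N -> nth 0 N r 0 j \is (nth 0%N e r).-homog) ->
  free_with_exponents B e.
Proof.
move=> ek; rewrite ek => lb hom; split.
  by exists (size e), (fun r : 'I_(size e) => der (nth 0 N r)).
exists (fun r : 'I_(size e) => der (nth 0 N r)) => // r j.
by rewrite derX; apply: hom.
Qed.

Lemma homog_mul_cst m l d k (th : 'rV[{mpoly K[l]}]_m) (M : 'M[K]_(m, k)) :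
  (forall j, th 0 j \is d.-homog) -> forall j, (th *m cst l M) 0 j \is d.-homog.
Proof.
move=> h j; rewrite mxE; apply: rpred_sum => i _.
by rewrite mxE mulrC mul_mpolyC; apply: rpredZ.
Qed.

Lemma nth_map_homog m l (rows : seq 'I_m) (N : 'I_m -> 'rV[{mpoly K[l]}]_l)
    (e : 'I_m -> nat) r j : (forall i, i \in rows -> N i 0 j \is (e i).-homog) ->
  (r < size rows)%N ->
  nth 0 [seq N i | i <- rows] r 0 j \is (nth 0%N [seq e i | i <- rows] r).-homog.
Proof.
case: rows => // i0 s h hr; rewrite !(nth_map i0) //; apply: h; exact: mem_nth.
Qed.

(** This is [log_basis_restr] with nothing restricted: all three matrices are the identity and no
    row is dropped. *)
Lemma saito_free_with_exponents A F T e (rows : seq 'I_n) : arrangement A ->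
  perm_eq F [seq hf H | H <- A] -> saito F T ->
  (forall i j, T i j \is (e i).-homog) -> perm_eq rows (enum 'I_n) ->
  free_with_exponents A [seq e i | i <- rows].
Proof.
move=> hA pF sT hom pr; have [_ tT _] := sT.
have map1 (G : seq 'rV[K]_n) : [seq a *m (1%:M : 'M[K]_n) | a <- G] = G.
  by rewrite (eq_map (@mulmx1 _ _ _)) map_id.
have lb := @log_basis_restr K V n 1%:M 1%:M 1%:M T F F A pred0 rows.
apply: (@log_basis_free V A _ (size rows)
  [seq map_mx (lsub 1%:M) (row i T) *m (cst n 1%:M)^T | i <- rows]).
- by rewrite size_map.
- apply: lb; rewrite ?mulmx1 ?map1 //.
  + split=> [H HA|a].
      by exists (hf H); rewrite ?(perm_mem pF) ?map_f // lker_hf // hA.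
    by rewrite (perm_mem pF) => /mapP [H HA ->]; right; rewrite lker_hf // hA.
  + by move=> a i ha; rewrite mulmx1; apply: tT.
  + move=> i _; rewrite /cst map_mx1 trmx1 mulmx1; split=> //.
    by apply/rowP => j; rewrite mxE lsub1.
  + by rewrite (perm_uniq pr) enum_uniq.
  + by move=> i; rewrite (perm_mem pr) mem_enum.
move=> r j hr; apply: nth_map_homog hr => i _.
rewrite map_trmx; apply: homog_mul_cst => l.
by rewrite mxE; apply: lsub_homog; rewrite mxE.
Qed.

Lemma mproj_us (bt us : 'I_n -> 'rV[K]_n) Y a i : dual_on bt us Y -> i \in Y ->
  dot (a *m mproj bt us (enum Y)) (us i) = 0.
Proof.
move=> d iY; rewrite mul_mproj dotBl dot_suml (bigD1_seq i) ?mem_enum ?enum_uniq //=.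
rewrite dotZl d // eqxx mulr1 big1_seq ?addr0 ?subrr // => z /andP [zi].
by rewrite mem_enum => zY; rewrite dotZl d // (negPf zi) mulr0.
Qed.

(** [P] encodes the projection onto [X] along the dual vectors, so [log_basis_restr] turns the rows
    outside [Y] into a basis on [X]. They keep their degrees, as linear substitutions and constant
    matrices preserve homogeneity. *)
Lemma good_restriction A F T e bt us Y (rows : seq 'I_n) : arrangement A ->
  perm_eq F [seq hf H | H <- A] -> saito F T ->
  (forall i j, T i j \is (e i).-homog) -> good F T bt us Y ->
  perm_eq rows (enum (~: Y)) ->
  exists X, [/\ in_lattice A X, (\dim X + #|Y|)%N = n &
    free_with_exponents (restriction A X) [seq e i | i <- rows]].
Proof.
move=> hA pF sT hom [btF dual [F' sF' subF']] pr; have [red tT _] := sT.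
pose X := (\bigcap_(y <- enum Y) lker (frm (bt y)))%VS.
set P := mproj bt us (enum Y) in subF' *; set N := mrestr bt us (enum Y) T in sF' *.
have btA y : y \in Y -> lker (frm (bt y)) \in A.
  by move=> /btF; rewrite (perm_mem pF) => /mapP [H HA ->]; rewrite lker_hf // hA.
have btP y : y \in Y -> bt y *m P = 0.
  move=> yY; apply: mproj_kill; rewrite ?enum_uniq ?mem_enum // => z.
  by rewrite mem_enum => zY; apply: dual.
have memX x : x \in X = all (fun y => dot (bt y) (cv x) == 0) (enum Y).
  by rewrite mem_bigcapv; apply: eq_all => y; rewrite mem_lker_frm.
have btX x y : x \in X -> y \in Y -> dot (bt y) (cv x) = 0.
  by rewrite memX => /allP h yY; apply/eqP/h; rewrite mem_enum.
have [||R [RJ JR PJ kill]] := @pull_retract K V X P.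
- move=> x xX; apply: dot_ext => b; rewrite -dot_mulr; apply: dot_mproj => y.
  by rewrite mem_enum; apply: btX.
- move=> w; rewrite memX; apply/allP => y; rewrite mem_enum => yY.
  by rewrite vcK -dot_mulr btP // /dot mul0mx mxE.
have rowN i : row i N = if i \in Y then cst n (us i) else map_mx (lsub P) (row i T).
  by rewrite row_mrestr mem_enum.
(* Row [i] of [T] is tangent to [bt y = 0], so its restriction annihilates [bt y] and does not
   distinguish [b] from [b *m P]. *)
have appP i b : i \notin Y -> app (map_mx (lsub P) (row i T)) (b *m P) =
    app (map_mx (lsub P) (row i T)) b.
  move=> iY; rewrite mul_mproj linearB /= -[RHS]subr0; congr (_ - _).
  rewrite [LHS]linear_sum big1_seq // => y; rewrite mem_enum => /andP [_ yY].
  rewrite /= linearZ /= -lsub_app; have [q ->] := tT i _ (btF _ yY).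
  by rewrite rmorphM /= lsub_lin btP // raddf0 mul0r scaler0.
have PP : P *m P = P.
  apply/row_matrixP => i; rewrite row_mul; apply: mproj_id => z.
  by rewrite mem_enum rowE; apply: mproj_us.
exists X; split.
- exists [fset H in [seq lker (frm (bt y)) | y <- enum Y]].
    apply/fsubsetP => H; rewrite !inE => /mapP [y]; rewrite mem_enum => yY ->.
    exact: btA.
  apply/vspaceP => x; rewrite mem_center mem_bigcapv; apply/allP/allP => h H.
    by rewrite !inE => /mapP [y yY ->]; apply: h.
  by move=> yY; apply: h; rewrite !inE; apply: map_f.
- rewrite cardE; apply: dim_bigcap_dual => [|y z]; first exact: enum_uniq.
  by rewrite !mem_enum; apply: dual.
apply: (@log_basis_free _ _ _ (size rows)
  [seq map_mx (lsub (pull X)) (row i N) *m (cst _ R)^T | i <- rows]).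
- by rewrite size_map.
- apply: (@log_basis_restr K _ n (pull X) R P N F F' _ (mem Y) rows) => //.
  + have [h1 h2] := forms_restriction X hA.
    have mF a : (a \in [seq b *m pull X | b <- F]) =
        (a \in [seq b *m pull X | b <- [seq hf H | H <- A]]).
      by apply: perm_mem; apply: perm_map.
    split=> [H /h1 [a ha e1]|a]; last by rewrite mF; apply: h2.
    by exists a; rewrite ?mF.
  + move=> a i aF; rewrite rowN; case: (boolP (i \in Y)) => iY.
      by rewrite app_cst mproj_us // raddf0; apply: pdvd0.
    by rewrite appP // -lsub_app -lsub_lin; apply: lsub_pdvd; apply: tT.
  + move=> i iY; rewrite rowN (negPf iY); split.
      by apply: app_ext => b; rewrite app_mulmx appP.
    by rewrite map_lsub_comp PP.
  + move=> i iY; rewrite rowN; have -> : i \in Y by [].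
    by apply: app_ext => b; rewrite app_mulmx app_cst mproj_us // raddf0 /app big1 // => j _; rewrite mxE scaler0.
  + by rewrite (perm_uniq pr) enum_uniq.
  + by move=> i; rewrite (perm_mem pr) mem_enum inE.
move=> r j hr; apply: nth_map_homog hr => i.
rewrite (perm_mem pr) mem_enum inE => iY.
rewrite map_trmx; apply: homog_mul_cst => l.
rewrite mxE; apply: lsub_homog; rewrite rowN (negPf iY) mxE.
by apply: lsub_homog; rewrite mxE.
Qed.

Lemma mat_free_accurate_from A : arrangement A -> MAT_free A ->
  accurate_from (\dim (center A)) A.
Proof.
move=> hA /(mat_inv_free hA) [F [T [e [k [pF [sT hom ek [bt [us [goodT _]]] lowT]]]]]].
pose srt (s : seq 'I_n) := sort (fun i j => e i <= e j)%N s.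
have map_srt s : [seq e i | i <- srt s] = sort leq [seq e i | i <- s].
  by rewrite sort_map.
exists (sort leq [seq e i | i <- enum 'I_n]); split.
- by rewrite size_sort size_map size_enum_ord.
- exact: sort_sorted leq_total _.
- rewrite -map_srt; apply: saito_free_with_exponents pF sT hom _ => //.
  by rewrite perm_sort.
move=> d /andP [cd dn].
have h0 := degree0_center hA pF sT hom.
have cE : (#|[set i | e i == 0%N]| + #|[set i | 0 < e i]|)%N = n.
  rewrite -[RHS]card_ord -(cardsC [set i | e i == 0%N]); congr (_ + _)%N.
  by apply: eq_card => i; rewrite !inE lt0n.
(* If [n - d] exceeds the number of top rows, an earlier block supplies [Y], the bound on
   degree-zero rows putting [n - d] in range. Otherwise any [n - d] top rows do, since their degree
   [k] is maximal. *)
have [Y [bt' [us' [cY gY ord]]]] : exists Y bt us, [/\ #|Y| = (n - d)%N,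
    good F T bt us Y & forall y i, y \in Y -> i \notin Y -> (e i <= e y)%N].
  have [jt|jt] := leqP (n - d) #|top e k|; last first.
    have [|Y [bt' [us' [h1 h2 h3 h4]]]] := lowT (n - d)%N; first by rewrite jt; lia.
    by exists Y, bt', us'.
  have [|Y [_ Yt cY]] := @exists_subset_between _ set0 (top e k) (n - d)%N (sub0set _).
    by rewrite cards0.
  exists Y, bt, us; split=> // [|y i /(subsetP Yt)]; first exact: goodT.
  by rewrite inE => /andP [/eqP -> _] _.
have [|X [h1 h2 h3]] := good_restriction (rows := srt (enum (~: Y))) hA pF sT hom gY.
  by rewrite perm_sort.
exists X; split=> //; first by lia.
have sd : size (enum (~: Y)) = d by rewrite -cardE cardsCs setCK cY card_ord subKn.
(* Degrees outside [Y] are at most those in [Y], so the exponents of the restriction are the first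
   [d] of the sorted list. *)
rewrite map_srt in h3; rewrite -sd (@take_sort_split _ e (enum (~: Y)) (enum Y)) //.
  apply: uniq_perm => [||i]; first exact: enum_uniq.
    rewrite cat_uniq !enum_uniq andbT; apply/hasPn => i.
    by rewrite !mem_enum inE negbK.
  by rewrite mem_cat !mem_enum !inE orNb.
by move=> i y; rewrite !mem_enum inE => iY yY; apply: ord.
Qed.

Lemma mat_free_accurate A : arrangement A -> MAT_free A ->
  (essential A -> accurate A) /\ accurate_from (maxn 1 (\dim (center A))) A.
Proof.
move=> hA hM; have [e [h1 h2 h3 h4]] := mat_free_accurate_from hA hM.
split=> [ess|]; exists e; split=> // d hd; apply: h4; last by lia.
suff -> : \dim (center A) = 0%N by lia.
have := dimvS (subvf (center A)); move: ess; rewrite /essential /rk; lia.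
Qed.

End Main.

Local Close Scope ring_scope.
Local Close Scope fset_scope.

(* Every X in L(A) contains the center of A, so an arrangement whose center has
   dimension at least 2 has no X with \dim X = 1 and is never accurate in the
   sense of [accurate].  For such A the statement ranges over all dimensions
   d >= 1 that are not excluded for this reason. *)
Theorem theorem1p2 :
  forall R : realType,
    (forall (V : vectType R) (A : {fset {vspace V}}),
        arrangement A -> MAT_free A ->
        (essential A -> accurate A) /\
        accurate_from (maxn 1 (\dim (center A))) A) /\
    (forall (V : vectType (complex R)) (A : {fset {vspace V}}),
        arrangement A -> MAT_free A ->
        (essential A -> accurate A) /\
        accurate_from (maxn 1 (\dim (center A))) A).
Proof. by move=> R; split=> V A; apply: mat_free_accurate. Qed.
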